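(* Let $\lambda$ be a shape. The geometric shard intersection order $\Psi^f(\lambda)$ is isomorphic, as a poset, to the lattice $\Psi^w(\lambda)$ of wide sets of segments of $\lambda$ ordered by inclusion.
   Context: A shape is a finite vertex-induced subgraph $\lambda$ of the square grid $\mathbb{Z}^2$ (two points are adjacent iff they differ by 1 in exactly one coordinate and agree in the other). $(a,b)$ is immediately South of $(a,b+1)$ and immediately East of $(a-1,b)$; North and West are the reverse relations. A vertex of $\lambda$ is interior if all four of its grid neighbors are in $\lambda$, and a boundary vertex otherwise; $V^o$ is the set of interior vertices. A (boundary) path is a sequence of vertices $(v_0,\ldots,v_l)$ of $\lambda$, $l>0$, with $v_0,v_l$ boundary vertices, $v_1,\dots,v_{l-1}$ interior vertices, and each $v_i$ immediately South or East of $v_{i-1}$. A segment is a sequence of interior vertices $(v_0,\ldots,v_l)$, $l\ge 0$, with each $v_i$ immediately South or East of $v_{i-1}$; $\mathrm{Seg}(\lambda)$ is the set of segments. The concatenation $s\circ t$ of segments is defined when the first vertex of $t$ is immediately South or East of the last vertex of $s$. If $t=(v_i,\dots,v_j)$ is a contiguous subsequence of a path or segment $p=(v_0,\dots,v_l)$, then $p$ starts with $t$ if $i=0$ and otherwise enters $t$ from the West (resp. North) if $v_{i-1}$ is immediately West (resp. North) of $v_i$; $p$ ends with $t$ if $j=l$ and otherwise leaves $t$ to the East (resp. South) if $v_{j+1}$ is immediately East (resp. South) of $v_j$. The same language is used for a single interior vertex $t=(v)$; a path $p$ turns at $v$ if it enters $v$ from the North and leaves to the East or enters $v$ from the West and leaves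 to the South. For a segment $s$: $A_s$ (SW-subsegments) is the set of subsegments $t\subseteq s$ such that $s$ starts with $t$ or enters $t$ from the North, and $s$ ends with $t$ or leaves $t$ to the East. $K_s$ (NE-subsegments) is the set of $t\subseteq s$ such that $s$ starts with $t$ or enters $t$ from the West, and $s$ ends with $t$ or leaves $t$ to the South. Segments $s,t$ are friendly along a common subsegment $u$ if $u\in A_s\cap K_t$ or $u\in K_s\cap A_t$. A set $T\subseteq\mathrm{Seg}(\lambda)$ is wide if: (i) for all segments $s,t,u$ with $s\circ t=u$, $|T\cap\{s,t,u\}|\ne2$; (ii) if $s,t\in T$ are friendly along $u$ then $u\in T$; (iii) if $s=s_1\circ s_2\circ s_3$ with $s,s_2\in T$ and $s_2\in A_s$ or $s_2\in K_s$, then $s_1,s_3\in T$. Two paths $p,q$ kiss along a common segment $s$ if (up to exchanging) $p$ enters $s$ from the West and leaves to the South, while $q$ enters $s$ from the North and leaves to the East. The reduced nonkissing complex $\widetilde\Delta^{NK}(\lambda)$ has as faces the sets (including $\emptyset$) of pairwise nonkissing paths that are neither horizontal (only East steps) nor vertical (only South steps). For a path $p$, $g_p\in\mathbb{R}^{V^o}$ has $g_p(v)=1$ if $p$ enters $v$ from the North and leaves to the East, $g_p(v)=-1$ if $p$ enters $v$ from the West and leaves to the South, and $g_p(v)=0$ otherwise. For a face $F$, $C(F)$ is the cone generated by $\{g_p:p\in F\}$. For a segment $s$, $\Delta_s$ is the set of faces $F$ of $\widetilde\Delta^{NK}(\lambda)$ such that for all $p\in F$ and every maximal subsegment $t$ of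 $s$ contained in $p$, $p$ turns at an even number of vertices of $t$. The shard of $s$ is $\Sigma(s)=\bigcup_{F\in\Delta_s}C(F)$. $\Psi^f(\lambda)$ is the poset of all intersections $\bigcap_{s\in I}\Sigma(s)$, $I\subseteq\mathrm{Seg}(\lambda)$ (the empty intersection being $\mathbb{R}^{V^o}$), ordered by reverse inclusion. *)

(* Defs.v *)
From HB Require Import structures.
From mathcomp Require Import all_boot all_order all_algebra.
From mathcomp Require Import finmap.
From mathcomp Require Import boolp classical_sets functions cardinality reals.
From mathcomp Require Import zify ring.

Set Implicit Arguments.
Unset Strict Implicit.
Unset Printing Implicit Defensive.

Import Order.TTheory GRing.Theory Num.Theory.

Local Open Scope classical_set_scope.
Local Open Scope card_scope.
Local Open Scope ring_scope.

(** * Shapes *)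

Definition grid_point := (int * int)%type.

Definition north (v : grid_point) : grid_point := (v.1, v.2 + 1).
Definition south (v : grid_point) : grid_point := (v.1, v.2 - 1).
Definition east (v : grid_point) : grid_point := (v.1 + 1, v.2).
Definition west (v : grid_point) : grid_point := (v.1 - 1, v.2).

(* A vertex-induced subgraph of the grid is determined by its vertices. *)
Definition grid_shape := {fset grid_point}.

Definition interior_vertices (lam : grid_shape) : {fset grid_point} :=
  [fset v in lam | [&& north v \in lam, south v \in lam,
                       east v \in lam & west v \in lam]]%fset.

Definition boundary_vertices (lam : grid_shape) : {fset grid_point} :=
  [fset v in lam | v \notin interior_vertices lam]%fset.

Definition step (u v : grid_point) : bool := (v == south u) || (v == east u).

(** * Paths and segments, as sequences of vertices *)

(* (v_0, ..., v_l) = v0 :: q; the vertices strictly between v_0 and v_l form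
   [behead (belast v0 q)]. *)
Definition is_path (lam : grid_shape) (p : seq grid_point) : bool :=
  if p is v0 :: q then
    [&& q != [::], v0 \in boundary_vertices lam, last v0 q \in boundary_vertices lam,
        all (fun v => v \in interior_vertices lam) (behead (belast v0 q))
      & path step v0 q]
  else false.

Definition is_segment (lam : grid_shape) (s : seq grid_point) : bool :=
  [&& s != [::], all (fun v => v \in interior_vertices lam) s & sorted step s].

Definition Seg (lam : grid_shape) : set (seq grid_point) :=
  [set s | is_segment lam s].

(* [u] is the concatenation of [s] and [t], which is required to be defined. *)
Definition is_concat (s t u : seq grid_point) : Prop :=
  if t is w :: _ then
    if s is v :: s' then step (last v s') w /\ u = s ++ t else False
  else False.

Definition subseg (t p : seq grid_point) : bool := (t != [::]) && infix t p.

(* Along a path or a segment the difference of the coordinates increases, so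
   the vertices are distinct and a nonempty contiguous subsequence [t] occurs
   only once in [p]; the vertex of [p] preceding (following) [t] is thus
   specified by extending [t] on the left (right). *)
Definition starts (p t : seq grid_point) : bool := prefix t p.
Definition ends (p t : seq grid_point) : bool := suffix t p.

Definition enters_west (p t : seq grid_point) : bool :=
  if t is v :: _ then infix (west v :: t) p else false.
Definition enters_north (p t : seq grid_point) : bool :=
  if t is v :: _ then infix (north v :: t) p else false.
Definition leaves_east (p t : seq grid_point) : bool :=
  if t is v :: t' then infix (rcons t (east (last v t'))) p else false.
Definition leaves_south (p t : seq grid_point) : bool :=
  if t is v :: t' then infix (rcons t (south (last v t'))) p else false.

Definition turns_NE (p : seq grid_point) (v : grid_point) : bool :=
  enters_north p [:: v] && leaves_east p [:: v].
Definition turns_WS (p : seq grid_point) (v : grid_point) : bool :=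
  enters_west p [:: v] && leaves_south p [:: v].
Definition turns (p : seq grid_point) (v : grid_point) : bool :=
  turns_NE p v || turns_WS p v.

(** * Wide sets of segments *)

Definition SWsub (s : seq grid_point) : set (seq grid_point) :=
  [set t | [&& subseg t s, starts s t || enters_north s t
             & ends s t || leaves_east s t]].
Definition NEsub (s : seq grid_point) : set (seq grid_point) :=
  [set t | [&& subseg t s, starts s t || enters_west s t
             & ends s t || leaves_south s t]].

Definition friendly (s t u : seq grid_point) : Prop :=
  (SWsub s `&` NEsub t) u \/ (NEsub s `&` SWsub t) u.

Definition wide (lam : grid_shape) (T : set (seq grid_point)) : Prop :=
  [/\ T `<=` Seg lam,
      forall s t u, Seg lam s -> Seg lam t -> Seg lam u -> is_concat s t u ->
        T `&` [set s; t; u] #!= `I_2,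
      forall s t u, T s -> T t -> friendly s t u -> T u
    & forall s1 s2 s3 s12 s, Seg lam s1 -> Seg lam s2 -> Seg lam s3 ->
        is_concat s1 s2 s12 -> is_concat s12 s3 s ->
        T s -> T s2 -> SWsub s s2 \/ NEsub s s2 -> T s1 /\ T s3].

(** ** Wide sets form a lattice

    Intersections of wide sets are wide, and [Seg lam] is wide. *)

Lemma card_setI3 (T : set (seq grid_point)) s t u :
  uniq [:: s; t; u] ->
  (T `&` [set s; t; u] #= `I_2) = (`[< T s >] + `[< T t >] + `[< T u >] == 2)%N.
Proof.
move=> stu.
pose r := [seq x <- [:: s; t; u] | `[< T x >]].
have -> : T `&` [set s; t; u] = [set` [fset x in r]%fset].
  apply/seteqP; split => x /=; rewrite !inE mem_filter !inE.
    by move=> [/asboolP -> [[->|->]|->]]; rewrite !eqxx ?orbT.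
  by move=> /andP[/asboolP Tx /or3P[] /eqP xE]; split=> //;
    [left; left|left; right|right].
have -> : (`[< T s >] + `[< T t >] + `[< T u >])%N = #|` [fset x in r]%fset |.
  have ur : uniq r by exact: filter_uniq.
  rewrite card_fseq undup_id // size_filter /= addn0.
  by rewrite addnA.
by apply/card_eq_fsetP/eqP.
Qed.

Lemma card_setI3P (T : set (seq grid_point)) s t u :
  uniq [:: s; t; u] ->
  (T `&` [set s; t; u] #!= `I_2) <->
  [/\ T s -> T t -> T u, T s -> T u -> T t & T t -> T u -> T s].
Proof.
move=> stu; rewrite card_setI3 //.
case: (asboolP (T s)) => Ts; case: (asboolP (T t)) => Tt;
  case: (asboolP (T u)) => Tu; split=> //= H; try by split.
- by case: H => H _ _; case: (Tu (H Ts Tt)).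
- by case: H => _ H _; case: (Tt (H Ts Tu)).
- by case: H => _ _ H; case: (Ts (H Tt Tu)).
Qed.

Lemma path_step_last v s :
  path step v s -> (last v s).1 - (last v s).2 = v.1 - v.2 + (size s)%:Z.
Proof.
elim: s v => [v _|w s IHs v] /=; first by rewrite addr0.
move=> /andP[vw /IHs ->]; rewrite -addn1 PoszD.
by case/orP: vw => /eqP -> /=; ring.
Qed.

Lemma is_concat_uniq lam s t u :
  Seg lam s -> is_concat s t u -> uniq [:: s; t; u].
Proof.
case: t s => [//|w t] [//|v s] /and3P[_ _ /= vs] [vw ->].
rewrite !inE; apply/and3P; split=> //; last first.
  by apply/eqP => /(congr1 size); rewrite /= size_cat /=; lia.
rewrite negb_or; apply/andP; split; last first.
  by apply/eqP => /(congr1 size); rewrite /= size_cat /=; lia.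
apply/eqP => -[vE _]; have := path_step_last vs.
by rewrite -vE in vw; case/orP: vw => /eqP/(congr1 (fun x => x.1 - x.2)) /=; lia.
Qed.

Lemma wide_bigcap lam (D : set (set (seq grid_point))) :
  D !=set0 -> (forall T, D T -> wide lam T) ->
  wide lam (\bigcap_(T in D) T).
Proof.
move=> [T0 DT0] Dw; split.
- by move=> s /(_ T0 DT0); case: (Dw T0 DT0) => + _ _ _; exact.
- move=> s t u Ss St Su stu; have U := is_concat_uniq Ss stu.
  apply/(card_setI3P _ U); split=> H1 H2 T DT;
    case: (Dw T DT) => _ /(_ s t u Ss St Su stu)/(card_setI3P _ U)[E1 E2 E3] _ _.
  + exact: E1 (H1 T DT) (H2 T DT).
  + exact: E2 (H1 T DT) (H2 T DT).
  + exact: E3 (H1 T DT) (H2 T DT).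
- move=> s t u Ts Tt f T DT; case: (Dw T DT) => _ _ H _.
  exact: H (Ts T DT) (Tt T DT) f.
- move=> s1 s2 s3 s12 s S1 S2 S3 c1 c2 Ts Ts2 AK; split=> T DT;
    case: (Dw T DT) => _ _ _ H;
    by case: (H _ _ _ _ _ S1 S2 S3 c1 c2 (Ts T DT) (Ts2 T DT) AK).
Qed.

Lemma subseg_segment lam t s : is_segment lam s -> subseg t s -> is_segment lam t.
Proof.
move=> /and3P[_ als srt] /andP[t0 /infixP[a [b sE]]].
rewrite /is_segment t0 /=; move: als srt; rewrite sE !all_cat.
move=> /and3P[_ -> _] /=.
by move=> /cat_sorted2[_ /cat_sorted2[]].
Qed.

Lemma wide_Seg lam : wide lam (Seg lam).
Proof.
split=> //.
- move=> s t u Ss St Su stu.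
  by apply/(card_setI3P _ (is_concat_uniq Ss stu)).
- move=> s t u Ss St [] [/and3P[us _ _] _]; exact: subseg_segment Ss us.
Qed.

(** * The reduced nonkissing complex *)

Definition kiss_along (p q s : seq grid_point) : Prop :=
  [/\ enters_west p s, leaves_south p s, enters_north q s & leaves_east q s].

Definition kiss (lam : grid_shape) (p q : seq grid_point) : Prop :=
  exists2 s, Seg lam s & kiss_along p q s \/ kiss_along q p s.

Definition horizontal (p : seq grid_point) : bool :=
  sorted (fun u v => v == east u) p.
Definition vertical (p : seq grid_point) : bool :=
  sorted (fun u v => v == south u) p.

Definition face (lam : grid_shape) (F : {fset seq grid_point}) : Prop :=
  (forall p, p \in F -> [&& is_path lam p, ~~ horizontal p & ~~ vertical p]) /\
  (forall p q, p \in F -> q \in F -> ~ kiss lam p q).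

(** * Cones and shards *)

(* The gspace [R^{V^o}]. *)
Definition gspace (R : realType) (lam : grid_shape) :=
  {ffun interior_vertices lam -> R}.

Definition gvec (R : realType) (lam : grid_shape) (p : seq grid_point) :
    gspace R lam :=
  [ffun v : interior_vertices lam =>
     if turns_NE p (val v) then 1 else if turns_WS p (val v) then -1 else 0].

Definition cone (R : realType) (lam : grid_shape) (F : {fset seq grid_point}) :
    set (gspace R lam) :=
  [set x | exists2 c : seq grid_point -> R, (forall p, p \in F -> 0 <= c p)
         & forall v, x v = \sum_(p <- F) c p * gvec R lam p v].
Arguments cone : clear implicits.

Definition max_common_subseg (s p t : seq grid_point) : Prop :=
  [/\ subseg t s, subseg t p
    & forall t', subseg t' s -> subseg t' p -> subseg t t' -> t' = t].

Definition shard_complex (lam : grid_shape) (s : seq grid_point) :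
    set {fset seq grid_point} :=
  [set F | face lam F /\
     forall p, p \in F -> forall t, max_common_subseg s p t ->
       ~~ odd (count (turns p) t)].

Definition shard (R : realType) (lam : grid_shape) (s : seq grid_point) :
    set (gspace R lam) :=
  \bigcup_(F in shard_complex lam s) cone R lam F.
Arguments shard : clear implicits.

(** * The two posets *)

Definition is_shard_intersection (R : realType) (lam : grid_shape)
    (X : set (gspace R lam)) : Prop :=
  exists2 I : set (seq grid_point), I `<=` Seg lam
    & X = \bigcap_(s in I) shard R lam s.

Definition Psi_f (R : realType) (lam : grid_shape) : Type :=
  {X : set (gspace R lam) | `[< is_shard_intersection X >]}.

Definition Psi_w (lam : grid_shape) : Type :=
  {T : set (seq grid_point) | `[< wide lam T >]}.

HB.instance Definition _ R lam := SubChoice.on (Psi_f R lam).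
HB.instance Definition _ lam := SubChoice.on (Psi_w lam).

Fact Psi_f_display : Order.disp_t. Proof. exact: Order.Disp tt tt. Qed.
Fact Psi_w_display : Order.disp_t. Proof. exact: Order.Disp tt tt. Qed.

Section GeometricOrder.
Variables (R : realType) (lam : grid_shape).
Implicit Types X Y Z : Psi_f R lam.

Definition Psi_f_le X Y : bool := `[< val Y `<=` val X >].

Fact Psi_f_le_refl : reflexive Psi_f_le.
Proof. by move=> X; apply/asboolP. Qed.

Fact Psi_f_le_anti : antisymmetric Psi_f_le.
Proof.
move=> X Y /andP[/asboolP YX /asboolP XY]; apply: val_inj.
by apply/seteqP; split.
Qed.

Fact Psi_f_le_trans : transitive Psi_f_le.
Proof.
move=> Y X Z /asboolP YX /asboolP ZY; apply/asboolP.
exact: subset_trans ZY YX.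
Qed.

HB.instance Definition _ :=
  Order.Le_isPOrder.Build Psi_f_display (Psi_f R lam)
    Psi_f_le_refl Psi_f_le_anti Psi_f_le_trans.

Lemma le_Psi_fE X Y : (X <= Y)%O = `[< val Y `<=` val X >].
Proof. by []. Qed.

End GeometricOrder.

Section WideOrder.
Variable lam : grid_shape.
Implicit Types T U W : Psi_w lam.

Definition Psi_w_le T U : bool := `[< val T `<=` val U >].

Fact Psi_w_le_refl : reflexive Psi_w_le.
Proof. by move=> T; apply/asboolP. Qed.

Fact Psi_w_le_anti : antisymmetric Psi_w_le.
Proof.
move=> T U /andP[/asboolP TU /asboolP UT]; apply: val_inj.
by apply/seteqP; split.
Qed.

Fact Psi_w_le_trans : transitive Psi_w_le.
Proof.
move=> U T W /asboolP TU /asboolP UW; apply/asboolP.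
exact: subset_trans TU UW.
Qed.

HB.instance Definition _ :=
  Order.Le_isPOrder.Build Psi_w_display (Psi_w lam)
    Psi_w_le_refl Psi_w_le_anti Psi_w_le_trans.

Fact Psi_w_inf_subproof (D : set (Psi_w lam)) :
  `[< wide lam (Seg lam `&` \bigcap_(T in D) val T) >].
Proof.
apply/asboolP.
have -> : Seg lam `&` \bigcap_(T in D) val T =
    \bigcap_(T in Seg lam |` [set val T | T in D]) T.
  by rewrite bigcap_setU bigcap_set1 bigcap_image.
apply: wide_bigcap; first by exists (Seg lam); left.
by move=> _ [->|[T _ <-]]; [exact: wide_Seg|exact/asboolP/(valP T)].
Qed.

Definition Psi_w_inf (D : set (Psi_w lam)) : Psi_w lam :=
  exist _ (Seg lam `&` \bigcap_(T in D) val T) (Psi_w_inf_subproof D).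

Fact Psi_w_le_inf T (D : set (Psi_w lam)) :
  Psi_w_le T (Psi_w_inf D) <-> forall U, D U -> Psi_w_le T U.
Proof.
split=> [/asboolP TD U DU|TD]; apply/asboolP => s Ts.
  by have [_ /(_ U DU)] := TD s Ts.
split; last by move=> U DU; exact: (asboolP _ (TD U DU)).
have /asboolP[+ _ _ _] := valP T; exact.
Qed.

Fact Psi_w_lexI T U W :
  Psi_w_le T (Psi_w_inf [set U; W]) = Psi_w_le T U && Psi_w_le T W.
Proof.
apply/idP/andP => [/Psi_w_le_inf TD|[TU TW]].
  by split; apply: TD; [left|right].
by apply/Psi_w_le_inf => _ [->|->].
Qed.

Fact Psi_w_leUx T U W :
  Psi_w_le (Psi_w_inf [set V | Psi_w_le T V /\ Psi_w_le U V]) W =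
  Psi_w_le T W && Psi_w_le U W.
Proof.
set J := Psi_w_inf _; apply/idP/andP => [JW|TUW].
  have TJ : Psi_w_le T J by apply/Psi_w_le_inf => V [].
  have UJ : Psi_w_le U J by apply/Psi_w_le_inf => V [].
  by split; [exact: Psi_w_le_trans TJ JW|exact: Psi_w_le_trans UJ JW].
have /Psi_w_le_inf JJ : Psi_w_le J J by exact: Psi_w_le_refl.
exact: JJ.
Qed.

HB.instance Definition _ :=
  Order.POrder_MeetJoin_isLattice.Build Psi_w_display (Psi_w lam)
    Psi_w_lexI Psi_w_leUx.

Lemma le_Psi_wE T U : (T <= U)%O = `[< val T `<=` val U >].
Proof. by []. Qed.

End WideOrder.

(* Main.v *)
(* [shard s] is the cone of the x in R^(V^o) for which [s], read as a string
   module with the SW-subsegments as subobjects and the NE-subsegments as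
   quotients, is x-semistable: x is nonnegative on the former and nonpositive on
   the latter. Indeed the g-vector of a path sums to 0, 1 or -1 on each run
   common with a segment, according to how the path enters and leaves the run,
   and a wrong sign exhibits either an odd run or a kiss. The segments semistable
   for a given x form a wide set, so that sending an intersection X of shards to
   the set of segments whose shard contains X is well defined, and it is
   injective by the usual Galois argument.

   For surjectivity, a segment s outside a wide set T has to be separated from
   it, and the g-vector of a single path does it. Since the torsion class and the
   torsion-free class generated by T meet in T, one of them, say the torsion
   class, misses s; take a minimal quotient u of s outside of it and a path which
   runs along u, entering from the North and leaving to the East. Whenever such a
   path, as built so far, ends at an interior vertex, one of its two extensions
   creates no odd run against T. *)
Require Import Defs.
From HB Require Import structures.
From mathcomp Require Import all_boot all_order all_algebra.
From mathcomp Require Import finmap.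
From mathcomp Require Import boolp classical_sets functions cardinality reals.
From mathcomp Require Import zify ring.

Set Implicit Arguments.
Unset Strict Implicit.
Unset Printing Implicit Defensive.

Import Order.TTheory GRing.Theory Num.Theory.

Local Open Scope classical_set_scope.
Local Open Scope ring_scope.

(** * Segments as words *)

Lemma cat_eq_cat (T : Type) (a b c d : seq T) : a ++ b = c ++ d ->
  (exists m, c = a ++ m /\ b = m ++ d) \/
  (exists m, [/\ m <> [::], a = c ++ m & d = m ++ b]).
Proof.
elim: a c => [|x a IHa] [|y c] /=.
- by move=> ->; left; exists [::].
- by move=> ->; left; exists (y :: c).
- by move=> <-; right; exists (x :: a).
- move=> [<- /IHa[[m [-> ->]]|[m [m0 -> ->]]]]; first by left; exists m.
  by right; exists m.
Qed.

(** The first letter of [t] occurs only once, and its index fixes the length of what precedes. *)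
Lemma uniq_cat_inj (T : eqType) (a b a' b' t : seq T) : t <> [::] ->
  uniq (a ++ t ++ b) -> a ++ t ++ b = a' ++ t ++ b' -> a = a' /\ b = b'.
Proof.
case: t => // v t _ U E.
have ia : size a = index v (a ++ (v :: t) ++ b).
  rewrite index_cat /= eqxx addn0; case: ifP => // va.
  by move: U; rewrite cat_uniq /= va andbF.
have ia' : size a' = index v (a ++ (v :: t) ++ b).
  move: U; rewrite E => U; rewrite index_cat /= eqxx addn0; case: ifP => // va.
  by move: U; rewrite cat_uniq /= va andbF.
have saa : size a = size a' by rewrite ia ia'.
move/eqP: E; rewrite eqseq_cat // eqseq_cat // => /and3P[/eqP-> _ /eqP->].
by [].
Qed.

Implicit Types (d e : bool) (a b t u v w s p : seq grid_point).

(* [true] stands for East and [false] for South. *)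
Definition move d (x : grid_point) : grid_point := if d then east x else south x.
Definition unmove d (x : grid_point) : grid_point := if d then west x else north x.

Lemma moveK d : cancel (move d) (unmove d).
Proof.
case: d => -[x y]; rewrite /move/unmove/east/west/south/north /=.
all: by congr pair; ring.
Qed.
Lemma unmoveK d : cancel (unmove d) (move d).
Proof.
case: d => -[x y]; rewrite /move/unmove/east/west/south/north /=.
all: by congr pair; ring.
Qed.

Lemma move_eq d x y : (y == move d x) = (x == unmove d y).
Proof. by apply/eqP/eqP => ->; rewrite ?moveK ?unmoveK. Qed.

Lemma stepE x y : step x y = (y == move true x) || (y == move false x).
Proof. by rewrite /step orbC. Qed.

Lemma move_inj2 d e x : move d x = move e x -> d = e.
Proof.
by case: d; case: e => //; rewrite /move/east/south => -[]; lia.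
Qed.

Lemma unmove_inj2 d e x : unmove d x = unmove e x -> d = e.
Proof.
by case: d; case: e => //; rewrite /unmove/west/north => -[]; lia.
Qed.

(* The junction of [a] and [t] is a step in direction [d]; vacuous when one of
   the two sequences is empty. *)
Definition link d a t : bool :=
  if a is x :: a' then if t is y :: _ then y == move d (last x a') else true
  else true.

Lemma link0r d a : link d a [::]. Proof. by case: a. Qed.

Lemma link_catr d a t b : t <> [::] -> link d a (t ++ b) = link d a t.
Proof. by case: t a => // y t []. Qed.

Lemma link_catl d a b t : a <> [::] -> link d (b ++ a) t = link d a t.
Proof. by case: a b => // x a [|y b] // _; rewrite /= last_cat. Qed.

Lemma link_catrW d a t b : link d a (t ++ b) -> link d a t.
Proof. by case: t => [|y t]; rewrite ?link0r // link_catr. Qed.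

Lemma link_catlW d a b t : link d (b ++ a) t -> link d a t.
Proof. by case: a => [|x a] //; rewrite link_catl. Qed.

Lemma link_inj d e a t : a <> [::] -> t <> [::] ->
  link d a t -> link e a t -> d = e.
Proof. by case: a t => // x a [|y t] // _ _ /= /eqP -> /eqP /move_inj2. Qed.

Lemma sorted_link a t : sorted step (a ++ t) -> exists d, link d a t.
Proof.
case: a t => [|x a] [|y t] //=; try by exists true.
rewrite cat_path /= => /and3P[_ + _].
by rewrite stepE => /orP[] H; [exists true|exists false].
Qed.

Lemma link_sorted d a t :
  sorted step a -> sorted step t -> link d a t -> sorted step (a ++ t).
Proof.
case: a t => [|x a] [|y t] //=; first by rewrite cats0.
rewrite cat_path /= => -> -> H; rewrite stepE.
by case: d H => ->; rewrite ?orbT.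
Qed.

Lemma step_level x y : step x y -> y.1 - y.2 = x.1 - x.2 + 1.
Proof. by case/orP => /eqP -> /=; ring. Qed.

Lemma sorted_step_uniq s : sorted step s -> uniq s.
Proof.
pose r (x y : grid_point) := (x.1 - x.2 < y.1 - y.2)%R.
move=> H; apply: (@sorted_uniq _ r); first by move=> ? ? ?; exact: lt_trans.
  by move=> x; rewrite /r ltxx.
by apply: sub_sorted H => x y /step_level; rewrite /r => ->; lia.
Qed.

(** The SW- and NE-conditions are mirror images under exchange of the two step directions. Indexing
    them by the direction of entry ([false] for SW, [true] for NE) lets each argument be carried out
    once, with [~~ d] for the dual case. *)
Definition dirsub d s t := exists a b,
  [/\ s = a ++ t ++ b, t <> [::], link d a t & link (~~ d) t b].

Lemma dirsub_refl d s : s <> [::] -> dirsub d s s.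
Proof. by move=> s0; exists [::], [::]; rewrite cats0 link0r. Qed.

Lemma dirsub_trans d s t u : dirsub d s t -> dirsub d t u -> dirsub d s u.
Proof.
move=> [a [b [-> t0 at_ tb]]] [a' [b' [tE u0 au ub]]]; subst t.
exists (a ++ a'), (b' ++ b); split=> //; first by rewrite !catA.
- case: a' at_ au {t0 tb} => [|x a'] at_ au; last by rewrite link_catl.
  by rewrite cats0; move: at_ => /= /link_catrW.
- case: b' tb ub {t0 at_} => [|x b'] tb ub; last by rewrite link_catr.
  by move: tb; rewrite cats0 => /link_catlW.
Qed.

Lemma dirsub_prefix d t b : t <> [::] -> link (~~ d) t b -> dirsub d (t ++ b) t.
Proof. by move=> t0 tb; exists [::], b. Qed.

Lemma dirsub_suffix d a t : t <> [::] -> link d a t -> dirsub d (a ++ t) t.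
Proof. by move=> t0 at_; exists a, [::]; rewrite cats0 link0r. Qed.

Definition enters d p t : bool := if t is v :: _ then infix (unmove d v :: t) p else false.
Definition leaves d p t : bool :=
  if t is v :: t' then infix (rcons t (move d (last v t'))) p else false.

Lemma entersE d a t b : t <> [::] -> uniq (a ++ t ++ b) ->
  enters d (a ++ t ++ b) t = (a != [::]) && link d a t.
Proof.
case: t => // v t _ U; apply/infixP/andP => [[a' [b' E]]|[]].
  have [] := uniq_cat_inj _ U (b' := b') (a' := rcons a' (unmove d v)) => //.
    by rewrite E cat_rcons.
  move=> -> _.
  by case: a' {E} => [|x a'] /=; rewrite ?last_rcons unmoveK.
case: a U => // x a _ _ /=; rewrite move_eq => /eqP <-.
exists (belast x a), b.
by rewrite -[LHS]cat_cons lastI cat_rcons.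
Qed.

Lemma leavesE d a t b : t <> [::] -> uniq (a ++ t ++ b) ->
  leaves d (a ++ t ++ b) t = (b != [::]) && link d t b.
Proof.
case: t => // v t _ U; apply/infixP/andP => [[a' [b' E]]|[]].
  have [] := uniq_cat_inj _ U (b' := move d (last v t) :: b') (a' := a') => //.
    by rewrite E cat_rcons.
  by move=> _ ->; rewrite /= eqxx.
case: b U => // x b _ _ /= /eqP ->.
by exists a, b; rewrite cat_rcons.
Qed.

Lemma startsE a t b : t <> [::] -> uniq (a ++ t ++ b) ->
  starts (a ++ t ++ b) t = (a == [::]).
Proof.
move=> t0 U; apply/prefixP/eqP => [[b' E]|->]; last by exists b.
by have [] := uniq_cat_inj t0 U (b' := b') (a' := [::]).
Qed.

Lemma endsE a t b : t <> [::] -> uniq (a ++ t ++ b) ->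
  ends (a ++ t ++ b) t = (b == [::]).
Proof.
move=> t0 U; apply/suffixP/eqP => [[b' E]|->]; last by exists a; rewrite cats0.
by have [] := uniq_cat_inj t0 U (b' := [::]) (a' := b') => //; rewrite cats0.
Qed.

Lemma dirsubP d s t : uniq s -> dirsub d s t <->
  [&& subseg t s, starts s t || enters d s t & ends s t || leaves (~~ d) s t].
Proof.
move=> U; split=> [[a [b [E t0 H1 H2]]]|].
  subst s; rewrite startsE ?endsE ?entersE ?leavesE // H1 H2 /subseg infix_infix.
  by move/eqP: t0 => ->; case: a {U H1}; case: b {H2}.
move=> /and3P[/andP[/eqP t0 /infixP[a [b E]]]]; subst s.
rewrite startsE ?endsE ?entersE ?leavesE // => H1 H2; exists a, b; split=> //.
  by case/orP: H1 => [/eqP->|/andP[]].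
by case/orP: H2 => [/eqP->|/andP[]//]; rewrite link0r.
Qed.

Lemma SWsubP s t : uniq s -> SWsub s t <-> dirsub false s t.
Proof. by move=> U; rewrite dirsubP. Qed.

Lemma NEsubP s t : uniq s -> NEsub s t <-> dirsub true s t.
Proof. by move=> U; rewrite dirsubP. Qed.

Lemma seg_uniq lam s : is_segment lam s -> uniq s.
Proof. by case/and3P => _ _ /sorted_step_uniq. Qed.

Lemma seg_nil lam s : is_segment lam s -> s <> [::].
Proof. by case/and3P => /eqP. Qed.

Lemma seg_catl lam a b : a <> [::] -> is_segment lam (a ++ b) -> is_segment lam a.
Proof.
move=> a0 /subseg_segment; apply; rewrite /subseg.
by apply/andP; split; [exact/eqP|exact/prefixW/prefix_prefix].
Qed.

Lemma seg_catr lam a b : b <> [::] -> is_segment lam (a ++ b) -> is_segment lam b.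
Proof.
move=> b0 /subseg_segment; apply; rewrite /subseg.
by apply/andP; split; [exact/eqP|exact/suffixW/suffix_suffix].
Qed.

Lemma seg_link lam a b : is_segment lam (a ++ b) -> exists d, link d a b.
Proof. by case/and3P => _ _ /sorted_link. Qed.

Lemma is_concatP lam s t u : is_segment lam u -> s <> [::] -> t <> [::] ->
  is_concat s t u <-> u = s ++ t.
Proof.
case: s t => // x s [] // y t /and3P[_ _ su] _ _; split=> [[]//|uE]; split=> //.
by move: su; rewrite uE /= cat_path /= => /and3P[].
Qed.

Lemma is_concatE s t u : is_concat s t u -> [/\ s <> [::], t <> [::] & u = s ++ t].
Proof. by case: t s => // y t [] // x s []. Qed.

(** * Separating a segment from a wide set *)

Lemma eq_or_negb d e : e = d \/ e = ~~ d.
Proof. by case: d; case: e; [left|right|right|left]. Qed.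

Lemma rcons_inj2 (X : eqType) (a b : seq X) x y : rcons a x = rcons b y -> a = b /\ x = y.
Proof. by move=> /eqP; rewrite eqseq_rcons => /andP[/eqP-> /eqP->]. Qed.

Section WideSets.
Variables (lam : grid_shape) (T : set (seq grid_point)) (wT : wide lam T).

Lemma wide_seg s : T s -> is_segment lam s.
Proof. by case: wT => + _ _ _; exact. Qed.

Lemma wide_nil s : T s -> s <> [::].
Proof. by move=> /wide_seg/seg_nil. Qed.

Lemma wide_cat a b : a <> [::] -> b <> [::] -> is_segment lam (a ++ b) ->
  [/\ T a -> T b -> T (a ++ b), T a -> T (a ++ b) -> T b & T b -> T (a ++ b) -> T a].
Proof.
move=> a0 b0 Sab; case: wT => _ /(_ a b (a ++ b)) + _ _.
have Sa := seg_catl a0 Sab; have Sb := seg_catr b0 Sab.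
have C : is_concat a b (a ++ b) by apply/is_concatP => //; exact: Sab.
by move=> /(_ Sa Sb Sab C) /(card_setI3P _ (is_concat_uniq Sa C)).
Qed.

Lemma wide_friendly d s t u : T s -> T t -> dirsub d s u -> dirsub (~~ d) t u -> T u.
Proof.
move=> Ts Tt su tu; case: wT => _ _ /(_ s t u Ts Tt) + _; apply.
have := seg_uniq (wide_seg Ts); have := seg_uniq (wide_seg Tt).
move=> Ut Us; case: d su tu => /= su tu; [right|left].
  by split; [exact/(NEsubP _ Us)|exact/(SWsubP _ Ut)].
by split; [exact/(SWsubP _ Us)|exact/(NEsubP _ Ut)].
Qed.

(** The two-out-of-three condition of [wide] supplies the cases where [a] or [b] is empty; if
    neither is, this is the last condition of [wide]. *)
Lemma wide_split d a v b : T (a ++ v ++ b) -> T v -> link d a v -> link (~~ d) v b ->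
  (a <> [::] -> T a) /\ (b <> [::] -> T b).
Proof.
move=> TT Tv av vb; have v0 := wide_nil Tv; have S := wide_seg TT.
case: (pselect (a = [::])) TT S av => [->|a0] TT S av.
  by split=> // b0; case: (wide_cat v0 b0 S) => _ H _; exact: H.
case: (pselect (b = [::])) TT S vb => [->|b0] TT S vb.
  split=> // _; rewrite cats0 in TT S.
  by case: (wide_cat a0 v0 S) => _ _; apply.
case: wT => _ _ _ /(_ a v b (a ++ v) (a ++ v ++ b)) H.
have Sav : is_segment lam (a ++ v).
  apply: (@seg_catl _ _ b); last by rewrite -catA.
  by case: (a) a0.
have [] // := H _ _ _ _ _ TT Tv.
- exact: seg_catl S.
- exact: wide_seg.
- by apply: (@seg_catr _ (a ++ v)) => //; rewrite -catA.
- by apply/(is_concatP Sav).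
- by apply/(is_concatP S) => //; [case: (a) a0|rewrite catA].
- have AB : dirsub d (a ++ v ++ b) v by exists a, b.
  have U := seg_uniq S.
  by case: d AB {av vb} => AB; [right; exact/(NEsubP _ U)|left; exact/(SWsubP _ U)].
Qed.

(* [gen true] consists of the quotients and [gen false] of the subobjects of
   members of [T]; their closures [genc] under extensions are a torsion class
   and a torsion-free class. *)
Definition gen d u := exists2 t, T t & dirsub d t u.

Lemma gen_nil d u : gen d u -> u <> [::].
Proof. by case=> t _ [a [b []]]. Qed.

Lemma gen_wide d u : gen d u -> gen (~~ d) u -> T u.
Proof. by move=> [s Ts su] [t Tt tu]; exact: wide_friendly Ts Tt su tu. Qed.

Lemma gen_sub d u v : gen d u -> dirsub d u v -> gen d v.
Proof. by move=> [t Tt tu] uv; exists t => //; exact: dirsub_trans tu uv. Qed.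

(** If [t] in [T] has [v ++ b] as a [d]-subsegment, then [v] is one too, so wideness splits [t]
    around [v]; the part to the right of [v] lies in [T] and begins with [b]. *)
Lemma gen_tail d v b : gen d (v ++ b) -> T v -> link (~~ d) v b -> b <> [::] -> gen d b.
Proof.
move=> [t Tt [a0 [b0 [tE _ l1 l2]]]] Tv vb nb; subst t; have v0 := wide_nil Tv.
exists (b ++ b0); last by apply: dirsub_prefix => //; exact: link_catlW l2.
move: Tt; rewrite -catA => /wide_split/(_ Tv)/(_ (link_catrW l1)) H.
have [|_] := H; first by rewrite link_catr.
by apply; case: (b) nb.
Qed.

Lemma gen_init d a v : gen d (a ++ v) -> T v -> link d a v -> a <> [::] -> gen d a.
Proof.
move=> [t Tt [a0 [b0 [tE _ l1 l2]]]] Tv av na; subst t; have v0 := wide_nil Tv.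
exists (a0 ++ a); last by apply: dirsub_suffix => //; exact: link_catrW l1.
move: Tt; rewrite -catA catA => /wide_split/(_ Tv) H.
have [||+ _] := H d; first by rewrite link_catl.
  exact: link_catlW l2.
by apply; case: (a0) (a) na => [|? ?] //.
Qed.

Inductive genc d : seq grid_point -> Prop :=
| genc_gen u : gen d u -> genc d u
| genc_cons u w : gen d u -> genc d w -> genc d (u ++ w).

Lemma genc_cat d u w : genc d u -> genc d w -> genc d (u ++ w).
Proof.
move=> cu cw; elim: cu => {u} [u gu|u v gu _ IH]; first exact: genc_cons.
by rewrite -catA; exact: genc_cons.
Qed.

Lemma gencP d u : genc d u -> exists u1 u2,
  [/\ u = u1 ++ u2, gen d u1 & u2 <> [::] -> genc d u2].
Proof.
case=> [{}u gu|{}u w gu cw]; first by exists u, [::]; rewrite cats0.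
by exists u, w.
Qed.

(** Generators before the cut are kept whole; one that is cut has a prefix left in direction [~~ d],
    which is again a generator. *)
Lemma genc_prefix d a b : genc d (a ++ b) -> a <> [::] -> link (~~ d) a b -> genc d a.
Proof.
move E : (a ++ b) => u cu; elim: cu a E => {u} [u gu|u w gu cw IH] a E a0 l.
  by subst u; apply: genc_gen; apply: gen_sub gu (dirsub_prefix a0 l).
case: (cat_eq_cat E) => [[m [uE bE]]|[m [m0 aE wE]]]; subst.
  apply: genc_gen; apply: gen_sub gu (dirsub_prefix a0 _).
  exact: link_catrW l.
by apply: genc_cons => //; apply: IH => //; exact: link_catlW l.
Qed.

Lemma genc_suffix d a b : genc d (a ++ b) -> b <> [::] -> link d a b -> genc d b.
Proof.
move E : (a ++ b) => u cu; elim: cu a E => {u} [u gu|u w gu cw IH] a E b0 l.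
  by subst u; apply: genc_gen; apply: gen_sub gu (dirsub_suffix b0 l).
case: (cat_eq_cat E) => [[m [uE bE]]|[m [m0 aE wE]]]; subst.
  case: (pselect (m = [::])) gu l => [->//|m0] gu l.
  by apply: genc_cons => //; apply: gen_sub gu (dirsub_suffix m0 (link_catrW l)).
by apply: (IH m) => //; exact: link_catlW l.
Qed.

(** Compares the first generators of the two filtrations of [u], the longer being [w1 = u1 ++ m].
    The direction of the step from [u1] to [m] decides which of these inherits membership in
    [gen (~~ d)]; proper suffixes of [u] are left to the induction hypothesis. *)
Lemma genc_wide_aux d u u1 u' w1 w' :
  (forall e x, (size x < size u)%N -> is_segment lam x ->
     genc e x -> genc (~~ e) x -> T x) ->
  is_segment lam u -> u = u1 ++ u' -> gen d u1 -> (u' <> [::] -> genc d u') ->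
  u = w1 ++ w' -> gen (~~ d) w1 -> (w' <> [::] -> genc (~~ d) w') ->
  (size u1 <= size w1)%N -> T u.
Proof.
move=> IH Su uE gu1 cu' wE gw1 cw' le_uw.
have u10 := gen_nil gu1; have w10 := gen_nil gw1.
have fin : T u1 -> (u' <> [::] -> T u') -> T u.
  move=> Tu1; case: (pselect (u' = [::])) => [u'0 _|u'0 /(_ u'0) Tu'].
    by rewrite uE u'0 cats0.
  by rewrite uE in Su *; case: (wide_cat u10 u'0 Su) => + _ _; exact.
have IHu' : u' <> [::] -> genc (~~ d) u' -> T u'.
  move=> u'0 cA; apply: (IH d) => //; last exact: cu'.
    by rewrite uE size_cat; case: (u1) u10 => //= *; lia.
  by rewrite uE in Su; exact: seg_catr Su.
have [m [mE u'E]] : exists m, w1 = u1 ++ m /\ u' = m ++ w'.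
  move: wE; rewrite uE => /cat_eq_cat[//|[m [m0 u1E _]]].
  by move: le_uw; rewrite u1E size_cat; case: (m) m0 => //= *; lia.
case: (pselect (m = [::])) => [m0|m0].
  rewrite m0 cats0 /= in mE u'E; subst w1 u'.
  apply: fin; first exact: gen_wide gu1 gw1.
  by move=> w'0; apply: IHu' => //; exact: cw'.
have u'0 : u' <> [::] by rewrite u'E; case: (m) m0.
have cA : gen (~~ d) m -> genc (~~ d) u'.
  rewrite u'E => gm; case: (pselect (w' = [::])) => [->|w'0].
    by rewrite cats0; exact: genc_gen.
  by apply: genc_cons => //; exact: cw'.
have [e le] : exists e, link e u1 m.
  apply: (@seg_link lam); apply: (@seg_catl _ _ w'); last by rewrite -catA -u'E -uE.
  by case: (u1) u10.
subst w1; case: (eq_or_negb d e) => ed.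
(* Here [u1] leaves [w1] in direction [d], so it is itself in [gen (~~ d)], and removing it from
   [w1] keeps [m] there. *)
- subst e; have Tu1 : T u1.
    apply: gen_wide gu1 _; apply: gen_sub gw1 _.
    by apply: dirsub_prefix; rewrite ?negbK.
  apply: fin => // _; apply: IHu' => //; apply: cA.
  by apply: gen_tail gw1 Tu1 _ m0; rewrite negbK.
(* Now [m] inherits [gen (~~ d)], which puts [u'] in [T]. Once [m] is in [T], so is [u1]; the step
   from [m] to [w'] decides how [m] gets there. *)
- subst e; have gm : gen (~~ d) m by apply: gen_sub gw1 _; exact: dirsub_suffix.
  have Tu' := IHu' u'0 (cA gm).
  suff Tm : T m.
    by apply: fin => //; apply: gen_wide gu1 _; exact: gen_init gw1 Tm le u10.
  case: (pselect (w' = [::])) => [w'0|w'0]; first by move: Tu'; rewrite u'E w'0 cats0.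
  have Smw := wide_seg Tu'; rewrite u'E in Smw Tu'.
  have [f lf] := seg_link Smw.
  case: (eq_or_negb d f) => fd.
  + subst f; suff Tw' : T w' by case: (wide_cat m0 w'0 Smw) => _ _; exact.
    apply: (IH d) => //; last exact: cw'.
    * rewrite wE !size_cat; case: (u1) u10 => //= *; lia.
    * exact: seg_catr Smw.
    * by rewrite u'E in cu' u'0; exact: genc_suffix (cu' u'0) w'0 lf.
  + subst f; apply: gen_wide gm _; rewrite negbK.
    by exists (m ++ w') => //; exact: dirsub_prefix.
Qed.

Lemma genc_wide d u : is_segment lam u -> genc d u -> genc (~~ d) u -> T u.
Proof.
have [n] := ubnP (size u); elim: n d u => // n IHn d u un Su cK cA.
have IH e x : (size x < size u)%N -> is_segment lam x ->
     genc e x -> genc (~~ e) x -> T x.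
  by move=> xu; apply: IHn; exact: leq_trans xu _.
have [u1 [u' [uE gu cu]]] := gencP cK; have [w1 [w' [wE gw cw]]] := gencP cA.
have [le|/ltnW le] := leqP (size u1) (size w1).
  exact: (genc_wide_aux IH Su uE gu cu wE gw cw le).
apply: (genc_wide_aux IH Su wE gw cw uE _ _ le); by rewrite negbK.
Qed.

(** For [d = true], the torsion class is closed under kernels of surjections onto members of [T]:
    [v] is a quotient of [v ++ b] with kernel [b]. A first generator longer than [v] is split by
    [gen_tail]; a shorter one is removed, and the rest [m] of [v] is again in [T]. *)
Lemma genc_kernel d v b : T v -> genc d (v ++ b) -> is_segment lam (v ++ b) ->
  link (~~ d) v b -> b <> [::] -> genc d b.
Proof.
have [n] := ubnP (size v); elim: n v => // n IHn v vn Tv cv S vb b0.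
have [k [k' [E gk ck]]] := gencP cv; have k0 := gen_nil gk; have v0 := wide_nil Tv.
case: (cat_eq_cat E) => [[m [kE bE]]|[m [m0 vE k'E]]]; subst.
  case: (pselect (m = [::])) gk vb b0 {E cv S} => [->|m0] gk vb b0.
    by apply: ck.
  have gm : gen d m by apply: gen_tail gk Tv (link_catrW vb) m0.
  case: (pselect (k' = [::])) => [->|k'0]; first by rewrite cats0; exact: genc_gen.
  by apply: genc_cons => //; exact: ck.
have Skm := wide_seg Tv; have [e le] := seg_link Skm.
have mb0 : m ++ b <> [::] by case: (m) m0.
have {}vb : link (~~ d) m b by exact: link_catlW vb.
have Smb : is_segment lam (m ++ b) by apply: (@seg_catr _ k) => //; rewrite catA.
apply: (IHn m) => //.
- by move: vn; rewrite size_cat; case: (k) k0 => //= *; lia.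
- case: (eq_or_negb d e) => ed.
  + subst e; have Tk : T k.
      apply: gen_wide gk _; exists (k ++ m) => //.
      by apply: dirsub_prefix; rewrite ?negbK.
    by case: (wide_cat k0 m0 Skm) => _ + _; exact.
  + subst e; apply: (@genc_wide d); first exact: seg_catr Skm.
      by apply: genc_prefix (ck mb0) _ _.
    by apply: genc_gen; exists (k ++ m) => //; exact: dirsub_suffix.
- exact: ck.
Qed.

(* A path is good when it is even on every member of [T], but goodness also
   makes sense for the truncated paths met while extending. *)
Definition good w := forall e a v b, w = a ++ v ++ b -> a <> [::] -> b <> [::] ->
  link e a v -> link (~~ e) v b -> ~ gen (~~ e) v.

(** By [genc_wide] one of the two classes misses [s]; descent on the length among [d]-subsegments
    then reaches a minimal one outside it. *)
Lemma not_wide_start s : is_segment lam s -> ~ T s ->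
  exists d u, [/\ dirsub d s u, ~ genc d u & forall x, dirsub d u x ->
    (size x < size u)%N -> genc d x].
Proof.
move=> Ss nTs.
have [d nds] : exists d, ~ genc d s.
  apply: contrapT => /forallNP H; apply: nTs; apply: (@genc_wide true) => //;
    exact: contrapT (H _).
have : dirsub d s s by exact/dirsub_refl/seg_nil/Ss.
move: nds; move: {1 3}s => u; have [n] := ubnP (size u).
elim: n u => // n IHn u un ndu su.
case: (pselect (exists x, [/\ dirsub d u x, (size x < size u)%N & ~ genc d x])).
  move=> [x [ux xu nx]]; apply: (IHn x) => //; first exact: leq_trans xu _.
  exact: dirsub_trans su ux.
move=> /forallNP H; exists d, u; split=> // x ux xu; apply: contrapT => nx.
exact: (H x).
Qed.

(** A bad run [v] would decompose [u = a ++ v ++ b] into members of [genc d], against the choice of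
    [u]. *)
Lemma good_start d u x y : is_segment lam u -> ~ genc d u ->
  (forall x, dirsub d u x -> (size x < size u)%N -> genc d x) ->
  link (~~ d) [:: x] u -> link d u [:: y] -> good (x :: u ++ [:: y]).
Proof.
move=> Su nu min xu uy e a v b E a0 b0 av vb gv.
have v0 := gen_nil gv.
case: a a0 av E => // x' a _ av [xx E]; subst x'.
case/lastP: b b0 vb E => // b y' _ vb E.
have {E} [E yy] : u = a ++ v ++ b /\ y = y'.
  by apply: rcons_inj2; rewrite !rcons_cat -cats1.
subst y' u.
have av' : a <> [::] -> link e a v by move=> ?; move: av; rewrite -cat1s link_catl.
have vb' : b <> [::] -> link (~~ e) v b by move=> ?; move: vb; rewrite -cats1 link_catr.
have u0 : a ++ v ++ b <> [::] by exact: seg_nil Su.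
have Cl : link (~~ d) a (v ++ b) -> a <> [::] -> genc d a.
  move=> l an; apply: min; first exact: dirsub_prefix.
  by rewrite !size_cat; case: (v) v0 => //= *; lia.
have Cr : link d (a ++ v) b -> b <> [::] -> genc d b.
  move=> l bn; apply: min; first by rewrite catA; exact: dirsub_suffix.
  by rewrite !size_cat; case: (v) v0 => //= *; lia.
case: (eq_or_negb d e) => ed.
(* The run lies strictly inside [u], because at the ends of [u] the path goes the other way. It
   belongs to both classes, hence to [T], and [genc_kernel] removes it from [v ++ b]. *)
- subst e.
  have an : a <> [::].
    move=> aE; subst a; have xv : link (~~ d) [:: x] v := link_catrW (t := v) xu.
    have x0 : [:: x] <> [::] by []; by case: (d) (link_inj x0 v0 av xv).
  have bn : b <> [::].
    move=> bE; subst b; rewrite cats0 in uy.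
    have vy : link d v [:: y] := link_catlW (a := v) uy.
    have y0 : [:: y] <> [::] by []; by case: (d) (link_inj v0 y0 vb vy).
  have {}av := av' an; have {}vb := vb' bn.
  have vb0 : v ++ b <> [::] by case: (v) v0.
  have cvb : genc d (v ++ b).
    apply: min; first by apply: dirsub_suffix; rewrite ?link_catr.
    by rewrite !size_cat; case: (a) an => //= *; lia.
  have cv : genc d v by apply: genc_prefix cvb _ _.
  have Svb : is_segment lam (v ++ b) by exact: seg_catr Su.
  have Tv : T v by apply: (@genc_wide d); [exact: seg_catl Svb| |exact: genc_gen].
  apply: nu; rewrite catA; apply: genc_cat; last exact: genc_kernel Tv cvb Svb vb bn.
  apply: min.
    by rewrite catA; apply: dirsub_prefix; rewrite ?link_catl //; case: (a) an.
  by rewrite !size_cat; case: (b) bn => //= *; lia.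
(* Here [v] is in [gen d], while [a] and [b], if nonempty, are proper [d]-subsegments of [u]. *)
- subst e; rewrite negbK in gv vb vb'.
  have cvb : genc d (v ++ b).
    case: (pselect (b = [::])) => [->|bn]; first by rewrite cats0; exact: genc_gen.
    apply: genc_cons => //; apply: Cr => //; rewrite link_catl //; exact: vb'.
  apply: nu; case: (pselect (a = [::])) => [->//|an].
  by apply: genc_cat => //; apply: Cl => //; rewrite link_catr //; exact: av'.
Qed.

(** A bad run created by the new vertex starts right after it, so it is a prefix of [w]. If both
    extensions failed, there would be two such prefixes, of different lengths as they are left in
    different directions; the shorter would lie in [T], and the rest of the longer would be a bad
    run of [w]. *)
Lemma good_extend_left w : w <> [::] -> good w ->
  exists d, good (unmove d (head (0, 0) w) :: w).
Proof.
move=> w0 gw; apply: contrapT => /forallNP H.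
have B e : exists v b, [/\ w = v ++ b, b <> [::], link (~~ e) v b & gen (~~ e) v].
  have := H e; move=> /existsNP[e' /existsNP[a /existsNP[v /existsNP[b]]]].
  move=> /not_implyP[E /not_implyP[a0 /not_implyP[b0]]].
  move=> /not_implyP[av /not_implyP[vb /contrapT gv]].
  have v0 := gen_nil gv; case: a E a0 av => // z a [zE E] _ av.
  case: (pselect (a = [::])) => [aE|an]; last first.
    case: (gw e' a v b) => //; move: av; rewrite -cat1s link_catl //.
  exists v, b; suff -> : e = e' by subst a.
  subst a z w; case: v v0 av {H w0 gw gv vb} => // y v _ /=.
  by rewrite move_eq => /eqP /unmove_inj2.
have [v [b [wE b0 vb gv]]] := B true; have [v' [b' [wE' b'0 vb' gv']]] := B false.
have main e x y z y' : w = x ++ y -> w = z ++ y' -> y <> [::] -> y' <> [::] ->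
    link (~~ e) x y -> link e z y' -> gen (~~ e) x -> gen e z -> (size x <= size z)%N -> False.
  move=> E E' y0 y'0 lx lz gx gz le; have x0 := gen_nil gx.
  have [m [mE yE]] : exists m, z = x ++ m /\ y = m ++ y'.
    move: E'; rewrite E => /cat_eq_cat[//|[m [m0 xE _]]].
    by move: le; rewrite xE size_cat; case: (m) m0 => //= *; lia.
  subst y z; case: (pselect (m = [::])) => [mE|m0].
    by subst m; rewrite cats0 in lz; have := link_inj x0 y0 lx lz; case: (e).
  have {}lx := link_catrW lx.
  have Tx : T x.
    by apply: (@gen_wide e); [apply: gen_sub gz _; exact: dirsub_prefix|].
  case: (gw (~~ e) x m y') => //; rewrite negbK //; first by rewrite (link_catlW lz).
  exact: gen_tail gz Tx lx m0.
have [le|/ltnW le] := leqP (size v) (size v').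
  exact: (main true v b v' b').
exact: (main false v' b' v b).
Qed.

Lemma good_extend_right w x : good (rcons w x) ->
  exists d, good (rcons (rcons w x) (move d x)).
Proof.
set w1 := rcons w x => gw; apply: contrapT => /forallNP H.
have B e : exists a v, [/\ w1 = a ++ v, a <> [::], link (~~ e) a v & gen e v].
  have := H e; move=> /existsNP[e' /existsNP[a /existsNP[v /existsNP[b]]]].
  move=> /not_implyP[E /not_implyP[a0 /not_implyP[b0]]].
  move=> /not_implyP[av /not_implyP[vb /contrapT gv]].
  have v0 := gen_nil gv; case/lastP: b E b0 vb => // b z E _ vb.
  have {E} [E zE] : w1 = a ++ v ++ b /\ move e x = z.
    by apply: rcons_inj2; rewrite !rcons_cat.
  case: (pselect (b = [::])) => [bE|bn]; last first.
    case: (gw e' a v b) => //; move: vb; rewrite -cats1 link_catr //.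
  exists a, v; suff -> : e = ~~ e' by subst b; rewrite negbK E cats0.
  subst b; rewrite cats0 in E; case/lastP: v v0 vb E {av gv} => // v y _ vb.
  rewrite -rcons_cat => /rcons_inj2[_ xy]; subst z y.
  case: v vb => [|y v] /=; rewrite ?last_rcons => /eqP; exact: move_inj2.
have [a [v [wE a0 av gv]]] := B true; have [a' [v' [wE' a'0 av' gv']]] := B false.
have main e y z y' z' : w1 = y ++ z -> w1 = y' ++ z' -> y <> [::] -> y' <> [::] ->
    link (~~ e) y z -> link e y' z' -> gen e z -> gen (~~ e) z' ->
    (size z <= size z')%N -> False.
  move=> E E' y0 y'0 lz lz' gz gz' le; have z0 := gen_nil gz.
  have [m [mE zE]] : exists m, z' = m ++ z /\ y = y' ++ m.
    have := E'; rewrite E => /cat_eq_cat[[m [m0 zE]]|[m [m0 -> ->]]]; last by exists m.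
    exists [::]; rewrite cats0 /=.
    have : size m = 0%N by move: le; rewrite zE size_cat; lia.
    by move/size0nil => mE; subst m; rewrite zE m0 cats0.
  subst y z'; case: (pselect (m = [::])) => [mE|m0].
    by subst m; rewrite cats0 in lz; have := link_inj y'0 z0 lz lz'; case: (e).
  have {}lz := link_catlW lz.
  have Tz : T z.
    by apply: (@gen_wide e) => //; apply: gen_sub gz' _; exact: dirsub_suffix.
  have wE3 : rcons w x = y' ++ m ++ z by rewrite -/w1 E -catA.
  apply: (gw e y' m z wE3 y'0 z0 _ lz); first exact: link_catrW lz'.
  exact: gen_init gz' Tz lz m0.
have [le|/ltnW le] := leqP (size v) (size v').
  exact: (main true a v a' v').
exact: (main false a' v' a v).
Qed.

End WideSets.

(** * Extension to boundary paths, and sums of turns along runs *)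

Lemma interior_lam lam x : x \in interior_vertices lam -> x \in lam.
Proof. by rewrite !inE => /andP[]. Qed.

Lemma interior_move lam d x : x \in interior_vertices lam -> move d x \in lam.
Proof. by rewrite !inE => /and5P[_ n so ea we]; case: d. Qed.

Lemma interior_unmove lam d x : x \in interior_vertices lam -> unmove d x \in lam.
Proof. by rewrite !inE => /and5P[_ n so ea we]; case: d. Qed.

Lemma boundaryE lam x : (x \in boundary_vertices lam) =
  (x \in lam) && (x \notin interior_vertices lam).
Proof. by rewrite !inE. Qed.

Lemma step_move d x : step x (move d x).
Proof. by rewrite stepE; case: d; rewrite eqxx ?orbT. Qed.

(** An interior end vertex has all its neighbors in the shape, so the path can be prolonged there.
    The vertices of a path are distinct, so the size of the shape bounds the number of
    prolongations. *)
Lemma extend_to_path lam T w0 x m y : wide lam T ->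
  m <> [::] -> all (fun z => z \in interior_vertices lam) m ->
  x \in lam -> y \in lam -> sorted step (x :: rcons m y) ->
  good T (x :: rcons m y) -> infix w0 (x :: rcons m y) ->
  exists p, [/\ is_path lam p, good T p & infix w0 p].
Proof.
move=> wT; have [n] := ubnP (size (enum_fset lam) - size m)%N.
elim: n x m y => // n IHn x m y mn m0 mint xl yl srt gw w0w.
have size_lt m' x' y' : all (fun z => z \in interior_vertices lam) m' ->
    x' \in lam -> y' \in lam -> sorted step (x' :: rcons m' y') ->
    (size m' < size (enum_fset lam))%N.
  move=> mi xl' yl' /sorted_step_uniq U.
  suff : (size (x' :: rcons m' y') <= size (enum_fset lam))%N.
    by rewrite /= size_rcons; lia.
  apply: uniq_leq_size => // z; rewrite inE mem_rcons inE.
  by case/or3P => [/eqP->|/eqP->|/(allP mi)/interior_lam].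
have sz := size_lt _ _ _ mint xl yl srt.
case: (boolP (x \in interior_vertices lam)) => xi.
  have [//|d gd] := good_extend_left wT _ gw.
  rewrite /= in gd; apply: (IHn (unmove d x) (x :: m) y) => //.
  - by move: mn sz => /=; lia.
  - by rewrite /= xi.
  - exact: interior_unmove.
  - by move: srt; rewrite /= => ->; rewrite -[X in step _ X](unmoveK d) step_move.
  - by apply: infix_trans w0w _; apply/infixP; exists [:: unmove d x], [::]; rewrite cats0.
case: (boolP (y \in interior_vertices lam)) => yi.
  have gw' : good T (rcons (x :: m) y) by [].
  have [d gd] := good_extend_right wT gw'.
  apply: (IHn x (rcons m y) (move d y)) => //.
  - by move: mn sz; rewrite size_rcons; lia.
  - by case: (m).
  - by rewrite all_rcons yi.
  - exact: interior_move.
  - by move: srt; rewrite /= !rcons_path last_rcons => ->; rewrite step_move.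
  - apply: infix_trans w0w _; apply/infixP; exists [::], [:: move d y].
    by rewrite -!rcons_cons -!cats1.
exists (x :: rcons m y); split=> //=.
rewrite !boundaryE xl xi last_rcons yl yi belast_rcons /= mint.
by move: srt => /= ->; rewrite !andbT; case: (m).
Qed.

Lemma exists_good_path lam T s : wide lam T -> is_segment lam s -> ~ T s ->
  exists d u a b, [/\ dirsub d s u, a <> [::] /\ b <> [::], link (~~ d) a u /\ link d u b,
    is_path lam (a ++ u ++ b) & good T (a ++ u ++ b)].
Proof.
move=> wT Ss nT; have [d [u [su nu min]]] := not_wide_start wT Ss nT.
have Su : is_segment lam u.
  by apply: (subseg_segment Ss); case/(dirsubP _ _ (seg_uniq Ss))/and3P: su.
have u0 := seg_nil Su.
case uE : u u0 => [//|v u'] _; case/lastP: u Su su nu min uE => // u l Su su nu min uE.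
have {}uE : v = head v (rcons u l) by rewrite uE.
(* With these neighbors the run is entered in direction [~~ d] and left in direction [d], as
   [good_start] requires. *)
set x := unmove (~~ d) v; set y := move d l.
have ui : all (fun z => z \in interior_vertices lam) (rcons u l) by case/and3P: Su.
have xu : link (~~ d) [:: x] (rcons u l).
  by rewrite /x; case: (u) uE => [|z u1] /= ->; rewrite unmoveK.
have uy : link d (rcons u l) [:: y].
  by case: (u) => [|z u1] /=; rewrite ?last_rcons.
have vi : v \in interior_vertices lam.
  by apply: (allP ui); case: (u) uE => [|z u1] /= ->; rewrite inE eqxx.
have li : l \in interior_vertices lam by apply: (allP ui); rewrite mem_rcons inE eqxx.
have srt : sorted step (x :: rcons (rcons u l) y).
  rewrite -cats1 -cat1s; apply: (@link_sorted (~~ d)) => //.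
    by apply: (@link_sorted d) => //; case/and3P: Su.
  by rewrite link_catr //; case: (u).
have gs : good T (x :: rcons (rcons u l) y).
  by rewrite -cats1; apply: (good_start wT Su nu min xu uy).
have [] := @extend_to_path lam T (x :: rcons (rcons u l) y) x (rcons u l) y wT.
- by case: (u).
- exact: ui.
- exact: interior_unmove.
- exact: interior_move.
- exact: srt.
- exact: gs.
- exact: infix_refl.
move=> p [pp gp /infixP[a [b pE]]].
exists d, (rcons u l), (rcons a x), (y :: b).
have -> : rcons a x ++ rcons u l ++ y :: b = p.
  by rewrite pE cat_rcons -[in RHS]cats1 /= -!catA.
split=> //; first by split=> //; case: (a).
split; first by rewrite -cats1 link_catl.
by rewrite -cat1s link_catr.
Qed.

Lemma linkE d e a t : a <> [::] -> t <> [::] -> link e a t -> link d a t = (d == e).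
Proof.
move=> a0 t0 l; apply/idP/eqP => [l'|-> //]; exact: link_inj a0 t0 l' l.
Qed.

(** * Turns of a boundary path along a segment *)

Section Runs.
Variable R : realDomainType.

Definition gturn p (v : grid_point) : R :=
  if turns_NE p v then 1 else if turns_WS p v then -1 else 0.

Lemma turns_at p e f a (v : grid_point) b :
  uniq p -> p = a ++ v :: b -> a <> [::] -> b <> [::] ->
  link e a [:: v] -> link f [:: v] b ->
  turns_NE p v = ~~ e && f /\ turns_WS p v = e && ~~ f.
Proof.
move=> U pE a0 b0 av vb; have {}pE : p = a ++ [:: v] ++ b by [].
have E d : enters d p [:: v] = (d == e).
  rewrite pE entersE //; last by rewrite -pE.
  by rewrite (linkE _ _ _ av) //; move/eqP: a0 => ->.
have L d : leaves d p [:: v] = (d == f).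
  rewrite pE leavesE //; last by rewrite -pE.
  by rewrite (linkE _ _ _ vb) //; move/eqP: b0 => ->.
split.
  have -> : turns_NE p v = enters false p [:: v] && leaves true p [:: v] by [].
  by rewrite E L; case: e {av E}; case: f {vb L}.
have -> : turns_WS p v = enters true p [:: v] && leaves false p [:: v] by [].
by rewrite E L; case: e {av E}; case: f {vb L}.
Qed.

(* The turns of a run telescope: in each vertex but the first, [p] enters in the
   direction in which it has left the preceding one. *)
Lemma run_turns p e f a t b : sorted step p -> p = a ++ t ++ b ->
  a <> [::] -> t <> [::] -> b <> [::] -> link e a t -> link f t b ->
  \sum_(v <- t) gturn p v = f%:R - e%:R /\ odd (count (turns p) t) = e (+) f.
Proof.
move=> srt; have U := sorted_step_uniq srt.
elim: t e a => // v t IH e a pE a0 _ b0 av vb.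
have [g l] : exists g, link g [:: v] (t ++ b).
  by apply: sorted_link; move: srt; rewrite pE => /cat_sorted2[].
have tb0 : t ++ b <> [::] by case: (t).
have av' : link e a [:: v] by move: av; rewrite -cat1s link_catr.
have [NE WS] := turns_at U pE a0 tb0 av' l.
have gv : gturn p v = g%:R - e%:R.
  by rewrite /gturn NE WS; case: (e) (g) => [] [] /=; rewrite ?subrr ?subr0 ?sub0r.
have tv : (turns p v : nat) = (e (+) g : nat).
  by rewrite /turns NE WS; case: (e) (g) => [] [].
rewrite big_cons /= gv tv oddD.
case: (pselect (t = [::])) vb l => [->|t0] vb l.
  have -> : g = f by exact: link_inj l vb.
  by rewrite big_nil /= addr0; case: (e) (f) => [] [].
have [||||-> ->] := IH g (rcons a v) _ _ t0 b0.
- by rewrite cat_rcons.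
- by case: (a).
- rewrite -cats1 link_catl //; exact: link_catrW l.
- by move: vb; rewrite -cat1s link_catl.
by split; [ring|case: (e) (f) (g) => [] [] []].
Qed.

Lemma is_path_sorted lam p : is_path lam p -> sorted step p.
Proof. by case: p => // v q /and5P[]. Qed.

Lemma path_split lam p a t b : is_path lam p -> is_segment lam t -> p = a ++ t ++ b ->
  a <> [::] /\ b <> [::].
Proof.
case: p => // x q /and5P[_ xb lb _ _] /and3P[t0 ti _] E.
move: xb lb; rewrite !boundaryE => /andP[_ /negP xb] /andP[_ /negP lb].
split=> [aE|bE].
  subst a; case: t t0 ti E => // y t _ /andP[yi _] [xy _]; by apply: xb; rewrite xy.
subst b; case/lastP: t t0 ti E => // t y _; rewrite all_rcons => /andP[yi _].
rewrite cats0 => /(congr1 (last x)); rewrite last_cat last_rcons /= => E.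
by apply: lb; rewrite E.
Qed.

Lemma infix_glue (X : eqType) (p : seq X) x y r : uniq p ->
  infix [:: x; y] p -> infix (y :: r) p -> infix (x :: y :: r) p.
Proof.
move=> U /infixP[a [b E]] /infixP[a' [b' E']].
have y0 : [:: y] <> [::] by [].
have [] := uniq_cat_inj y0 (a := rcons a x) (b := b) (a' := a') (b' := r ++ b') (t := [:: y]).
- by rewrite cat_rcons /= -[_ ++ _]E.
- by rewrite cat_rcons /= -[LHS]E E'.
move=> aE _; apply/infixP; exists a, b'; by rewrite E' -aE cat_rcons.
Qed.

(** Pairs traversed by [p] glue along their common vertex, which occurs once in [p]. Hence a word of
    two or more letters that is no run of [p] can be cut at a pair that [p] does not traverse. *)
Lemma infix_or_split p t : uniq p -> t <> [::] ->
  [\/ infix t p, exists2 v : grid_point, t = [:: v] & v \notin p |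
      exists a x y b, t = rcons a x ++ y :: b /\ ~~ infix [:: x; y] p].
Proof.
move=> U; elim: t => // x [|y t] IH _.
  case: (boolP (x \in p)) => xp; last by constructor 2; exists x.
  by constructor 1; move/splitPr: xp => [a b]; apply/infixP; exists a, b.
case: (boolP (infix [:: x; y] p)) => xy; last by constructor 3; exists [::], x, y, t.
have [//|yt|[v [vE _]] vp|[a [z [z' [b [E nz]]]]]] := IH.
- by constructor 1; exact: infix_glue.
- by case/negP: vp; rewrite -vE; apply: (mem_infix xy); rewrite !inE eqxx orbT.
- by constructor 3; exists (x :: a), z, z', b; rewrite E.
Qed.

Lemma gturn_notin p (v : grid_point) : v \notin p -> gturn p v = 0.
Proof.
move=> vp; have E d : enters d p [:: v] = false.
  apply/negP => /mem_infix/(_ v); rewrite !inE eqxx orbT => /(_ isT) H.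
  by rewrite H in vp.
rewrite /gturn.
have -> : turns_NE p v = enters false p [:: v] && leaves true p [:: v] by [].
have -> : turns_WS p v = enters true p [:: v] && leaves false p [:: v] by [].
by rewrite !E.
Qed.

(** For [d = true] the path enters from the North and leaves to the East, opposite at both ends to
    the directions in [dirsub d]. *)
Definition passes d p w := exists a b,
  [/\ p = a ++ w ++ b, a <> [::], b <> [::], link (~~ d) a w & link d w b].

(** When [t] is cut at a step that [p] does not make, one half keeps a negative signed sum and
    yields [w] by induction. If [w] touches the cut, [t] and [p] part there in different directions,
    as [dirsub d t w] demands. *)
Lemma negative_turns lam d p t : is_path lam p -> is_segment lam t ->
  (-1) ^+ d * \sum_(v <- t) gturn p v < 0 -> exists2 w, dirsub d t w & passes d p w.
Proof.
move=> pp; have srt := is_path_sorted pp; have U := sorted_step_uniq srt.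
have [n] := ubnP (size t); elim: n t => // n IHn t tn St neg.
have t0 := seg_nil St.
case: (infix_or_split U t0) => [/infixP[a [b pE]]|[v tE vp]|[a [x [y [b [tE xy]]]]]].
- have [a0 b0] := path_split pp St pE.
  have [e le] : exists e, link e a (t ++ b) by apply: sorted_link; rewrite -pE.
  have [f lf] : exists f, link f t b.
    by apply: sorted_link; move: srt; rewrite pE => /cat_sorted2[].
  rewrite link_catr // in le.
  move: neg; rewrite (run_turns srt pE a0 t0 b0 le lf).1 => neg.
  (* By telescoping, only this pair of directions makes the signed sum negative. *)
  have [ee ff] : e = ~~ d /\ f = d.
    move: neg; case: (d) (e) (f) => [] [] [] /=;
      rewrite ?expr1 ?expr0 ?subrr ?mulr0 ?ltxx ?subr0 ?sub0r ?mulN1r ?mul1r ?opprK //;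
      by rewrite ltr10.
  subst e f; exists t; first exact: dirsub_refl.
  by exists a, b.
- by move: neg; rewrite tE big_seq1 gturn_notin // mulr0 ltxx.
have ax0 : rcons a x <> [::] by case: (a).
have yb0 : y :: b <> [::] by [].
have Stt := St; rewrite tE in Stt.
have Sa := seg_catl ax0 Stt; have Sb := seg_catr yb0 Stt.
have [g lg] := seg_link Stt.
have lxy : y = move g x by move: lg; case: (a) => [|z a'] /=; rewrite ?last_rcons => /eqP.
move: neg; rewrite tE big_cat mulrDr => neg.
case: (ltP ((-1) ^+ d * \sum_(v <- rcons a x) gturn p v) 0) => [neg1|nn1].
  have [|w aw pw] := IHn (rcons a x) _ Sa neg1.
    by move: tn; rewrite tE size_cat /=; clear; lia.
  exists w => //; move: aw => [a1 [b1 [aE w0 l1 l2]]]; exists a1, (b1 ++ y :: b).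
  split=> //; first by rewrite aE -!catA.
  case: (pselect (b1 = [::])) => [b1E|b10]; last by rewrite link_catr.
  subst b1; rewrite cats0 /= in aE *.
  have lw : link g w (y :: b) by move: lg; rewrite aE link_catl.
  (* If [t] crossed the cut in direction [d], it would make the very step by which [p] leaves [w],
     against the choice of the cut. *)
  case: (eq_or_negb d g) => gd; last by rewrite -gd.
  case/lastP: w w0 aE pw {l1 l2 lw} => // w x' _; rewrite -rcons_cat => /rcons_inj2[_ <-].
  move=> [pa [pb [pE _ pb0 _ lpb]]]; case: pb pb0 pE lpb => // y' pb _ pE lpb.
  case/negP: xy; apply/infixP; exists (pa ++ w), pb.
  rewrite pE -catA cat_rcons; congr (_ ++ (_ ++ _ :: _ :: _)).
  rewrite lxy gd; move: lpb; case: (w) => [|z w'] /=; rewrite ?last_rcons => /eqP //.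
case: (ltP ((-1) ^+ d * \sum_(v <- y :: b) gturn p v) 0) => [neg1|nn2]; last first.
  by have := addr_ge0 nn1 nn2; rewrite leNgt neg.
have [|w aw pw] := IHn (y :: b) _ Sb neg1.
  by move: tn; rewrite tE size_cat size_rcons /=; clear; lia.
exists w => //; move: aw => [a1 [b1 [aE w0 l1 l2]]]; exists (rcons a x ++ a1), b1.
split=> //; first by rewrite aE -!catA.
case: (pselect (a1 = [::])) => [a1E|a10]; last by rewrite link_catl.
subst a1; rewrite cats0 /= in aE *.
have lw : link g (rcons a x) w by move: lg; rewrite aE link_catr.
case: (eq_or_negb d g) => gd; first by rewrite -gd.
case: w w0 aE pw {l1 l2 lw} => // y' w _ [<- _].
move=> [pa [pb [pE pa0 _ lpa _]]]; case/lastP: pa pa0 pE lpa => // pa x' _ pE lpa.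
case/negP: xy; apply/infixP; exists pa, (w ++ pb).
rewrite pE cat_rcons /=; congr (_ ++ _ :: _ :: _).
have : y = move (~~ d) x' by move: lpa; case: (pa) => [|z pa'] /=; rewrite ?last_rcons => /eqP.
by rewrite lxy -gd => /(can_inj (moveK _)) ->.
Qed.

End Runs.

(** * Shards and semistability *)

(** An odd number of turns means that [p] enters and leaves [t] in different directions. By
    maximality [s] and [p] share no vertex next to [t], so [s] takes the other direction at each end
    that is not its own. *)
Lemma max_common_dirsub lam p s t : is_path lam p -> is_segment lam s ->
  max_common_subseg s p t -> odd (count (turns p) t) ->
  exists2 d, dirsub d s t & passes d p t.
Proof.
move=> pp Ss [ts tp tmax] ot; have srt := is_path_sorted pp.
have U := sorted_step_uniq srt; have Us := seg_uniq Ss.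
have St := subseg_segment Ss ts; have t0 := seg_nil St.
have /andP[_ /infixP[a [b pE]]] := tp; have /andP[_ /infixP[a1 [b1 sE]]] := ts.
have [a0 b0] := path_split pp St pE.
have [e le] : exists e, link e a t.
  have [e le] : exists e, link e a (t ++ b) by apply: sorted_link; rewrite -pE.
  by exists e; exact: link_catrW le.
have [f lf] : exists f, link f t b.
  by apply: sorted_link; move: srt; rewrite pE => /cat_sorted2[].
have := (run_turns int srt pE a0 t0 b0 le lf).2; rewrite ot => /esym ef.
have {ef} eE : e = ~~ f by case: (e) (f) ef => [] [].
subst e; exists f; last by exists a, b.
exists a1, b1; split=> //.
- case/lastP: a1 sE => // a1 x sE; case/lastP: a a0 pE le => // a x' _ pE le.
  have [g lg] : exists g, link g [:: x] t.
    apply: sorted_link; have /and3P[_ _] := Ss; rewrite sE cat_rcons.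
    by move=> /cat_sorted2[_]; rewrite -cat1s catA => /cat_sorted2[].
  case: (eq_or_negb f g) => gf.
    by rewrite -cats1 link_catl // -gf.
  have xx : x = x'.
    case: t t0 lg le {ts tp tmax ot St pE sE lf} => // y t _ /= /eqP ->.
    rewrite gf; case: a => [|z a] /=; rewrite ?last_rcons => /eqP;
    by move/(can_inj (moveK _)).
  have := tmax (x :: t); rewrite /subseg /= sE pE xx => H.
  have [] : x' :: t <> t by move=> /(congr1 size)/esym/n_Sn.
  apply: H.
  + by apply/infixP; exists a1, b1; rewrite cat_rcons.
  + by apply/infixP; exists a, b; rewrite cat_rcons.
  + by rewrite infix_refl orbT andbT; exact/eqP.
- case: b1 sE => [|x b1] sE; first by rewrite link0r.
  case: b b0 pE lf => // x' b _ pE lf.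
  have [g lg] : exists g, link g t [:: x].
    apply: sorted_link; have /and3P[_ _] := Ss; rewrite sE.
    by move=> /cat_sorted2[_]; rewrite -cat1s catA => /cat_sorted2[].
  case: (eq_or_negb f g) => gf; last by rewrite -cat1s link_catr // -gf.
  have xx : x = x'.
    by case: t t0 lg lf {ts tp tmax ot St pE sE le} => // y t _ /= /eqP ->; rewrite gf => /eqP.
  have := tmax (rcons t x); rewrite /subseg /= sE pE xx => H.
  have [] : rcons t x' <> t by move=> /(congr1 size); rewrite size_rcons => /esym/n_Sn.
  apply: H.
  + by apply/andP; split; [case: (t)|apply/infixP; exists a1, b1; rewrite cat_rcons].
  + by apply/andP; split; [case: (t)|apply/infixP; exists a, b; rewrite cat_rcons].
  + by apply/andP; split; [exact/eqP|apply/infixP; exists [::], [:: x']; rewrite cats1].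
Qed.

(** Converse of [max_common_dirsub]: [s] and [p] disagree at both ends of [w], so no common
    subsegment prolongs it. *)
Lemma dirsub_passes_max lam d p s w : is_path lam p -> is_segment lam s ->
  dirsub d s w -> passes d p w ->
  max_common_subseg s p w /\ odd (count (turns p) w).
Proof.
move=> pp Ss [a1 [b1 [sE w0 l1 l2]]] [a [b [pE a0 b0 la lb]]].
have srt := is_path_sorted pp; have U := sorted_step_uniq srt; have Us := seg_uniq Ss.
have w0' : w != [::] by exact/eqP.
split; last by rewrite (run_turns int srt pE a0 w0 b0 la lb).2; case: (d).
split; rewrite /subseg.
- by rewrite w0'; apply/infixP; exists a1, b1.
- by rewrite w0'; apply/infixP; exists a, b.
move=> t' /andP[_ /infixP[c [c' sE']]] /andP[_ /infixP[f [f' pE']]] /andP[_ /infixP[x [y tE]]].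
subst t'; rewrite sE in Us; have [|aE bE] := uniq_cat_inj w0 Us (a' := c ++ x) (b' := y ++ c').
  by rewrite -sE sE' -!catA.
rewrite pE in U; have [|aE' bE'] := uniq_cat_inj w0 U (a' := f ++ x) (b' := y ++ f').
  by rewrite -pE pE' -!catA.
subst a1 b1 a b.
have -> : x = [::].
  apply: contrapT => x0; have := link_inj x0 w0 (link_catlW l1) (link_catlW la).
  by case: (d).
have -> : y = [::].
  apply: contrapT => y0; have := link_inj w0 y0 (link_catrW l2) (link_catrW lb).
  by case: (d).
by rewrite cats0.
Qed.

(** * Semistable segments form a wide set *)

Section Semistable.
Variables (R : realDomainType) (phi : seq grid_point -> R).
Hypothesis phi_cat : forall a b, phi (a ++ b) = phi a + phi b.

(* King's semistability with respect to [phi]: subobjects and quotients of [s]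
   have opposite signs, so that [phi s = 0]. *)
Definition semistable s := forall d t, dirsub d s t -> 0 <= (-1) ^+ d * phi t.

Lemma semistable0 s : s <> [::] -> semistable s -> phi s = 0.
Proof.
move=> s0 ss; have := ss true s (dirsub_refl _ s0); have := ss false s (dirsub_refl _ s0).
by rewrite expr0 expr1 mul1r mulN1r oppr_ge0 => ? ?; apply/eqP; rewrite eq_le; apply/andP.
Qed.

Lemma semistable_sub d s t r : semistable s -> dirsub d s t -> dirsub d t r ->
  0 <= (-1) ^+ d * phi r.
Proof. by move=> ss st tr; apply: ss; exact: dirsub_trans st tr. Qed.

(** A [d]-subsegment across the junction splits there into [d]-subsegments of [s] and of [t]. *)
Lemma semistable_cat s t : semistable s -> semistable t -> semistable (s ++ t).
Proof.
move=> ss tt d r [a [b [E r0 l1 l2]]].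
case: (cat_eq_cat E) => [[m [aE tE]]|[m [m0 sE rE]]].
  apply: tt; exists m, b; split=> //; subst a.
  exact: link_catlW l1.
case: (cat_eq_cat rE) => [[m' [mE bE]]|[m' [m'0 rE' tE]]].
  by subst m b; apply: ss; exists a, m'; split=> //; exact: link_catrW l2.
subst r; rewrite phi_cat mulrDr addr_ge0 //.
  by apply: ss; rewrite sE; apply: dirsub_suffix => //; exact: link_catrW l1.
by apply: tt; rewrite tE; apply: dirsub_prefix => //; exact: link_catlW l2.
Qed.

(** Only an initial part [r] of [t] reached in the wrong direction needs care: then [s ++ r] is a
    [d]-subsegment of the whole, and [phi s = 0]. *)
Lemma semistable_catr s t e : s <> [::] -> link e s t ->
  semistable s -> semistable (s ++ t) -> semistable t.
Proof.
move=> s0 l ss st d r [a [b [E r0 l1 l2]]]; subst t.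
case: (pselect (a = [::])) => [aE|a0]; last first.
  apply: st; exists (s ++ a), b; split=> //; first by rewrite -!catA.
  by rewrite link_catl.
subst a; rewrite /= link_catr // in l.
case: (eq_or_negb d e) => ed; subst e.
  by apply: st; exists s, b.
have : 0 <= (-1) ^+ d * phi (s ++ r).
  apply: st; exists [::], b; split=> //; first by rewrite /= -catA.
    by case: (s) s0.
  by rewrite link_catl.
by rewrite phi_cat (semistable0 s0 ss) add0r.
Qed.

Lemma semistable_catl s t e : t <> [::] -> link e s t ->
  semistable t -> semistable (s ++ t) -> semistable s.
Proof.
move=> t0 l tt st d r [a [b [E r0 l1 l2]]]; subst s.
case: (pselect (b = [::])) => [bE|b0]; last first.
  apply: st; exists a, (b ++ t); split=> //; first by rewrite -!catA.
  by rewrite link_catr.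
subst b; rewrite cats0 link_catl // in l *.
case: (eq_or_negb d e) => ed; subst e; last first.
  by apply: st; exists a, t; rewrite cats0 -catA.
have : 0 <= (-1) ^+ d * phi (r ++ t).
  apply: st; exists a, [::]; split=> //; first by rewrite !cats0 -catA.
    by case: (r) r0.
  - by rewrite link_catr.
  - by rewrite link0r.
by rewrite phi_cat (semistable0 t0 tt) addr0.
Qed.

(** A part of [a] or [b] that meets [v] in the wrong direction is enlarged by [v], on which [phi]
    vanishes; the other end of [v] has the direction required. *)
Lemma semistable_split d a v b : semistable (a ++ v ++ b) -> semistable v ->
  a <> [::] -> v <> [::] -> b <> [::] -> link d a v -> link (~~ d) v b ->
  semistable a /\ semistable b.
Proof.
move=> ss sv a0 v0 b0 l1 l2; have pv := semistable0 v0 sv.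
have pa : 0 <= (-1) ^+ (~~ d) * phi a.
  by apply: ss; apply: dirsub_prefix => //; rewrite negbK link_catr.
split=> e r [x [y [E r0 m1 m2]]]; subst.
- case: (pselect (y = [::])) => [yE|y0]; last first.
    by apply: ss; exists x, (y ++ v ++ b); split; rewrite -?catA ?link_catr.
  subst y; rewrite cats0 in ss l1 a0 pa *; rewrite link_catl // in l1.
  case: (eq_or_negb e d) => ed; subst d; last first.
    by apply: ss; exists x, (v ++ b); split; rewrite -?catA ?link_catr.
  have : 0 <= (-1) ^+ e * phi (r ++ v).
    apply: ss; exists x, b; split; rewrite -?catA ?link_catr ?link_catl //.
    by case: (r) r0.
  by rewrite phi_cat pv addr0.
- case: (pselect (x = [::])) => [xE|x0]; last first.
    apply: ss; exists (a ++ v ++ x), y; split=> //; rewrite -?catA // !link_catl //.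
    by case: (v) v0.
  subst x; rewrite /= link_catr // in l2.
  case: (eq_or_negb e d) => ed; subst d; last first.
    rewrite negbK in l2; apply: ss; exists (a ++ v), y; split=> //; rewrite -?catA //.
    by rewrite link_catl.
  have : 0 <= (-1) ^+ e * phi (v ++ r).
    apply: ss; exists a, y; split; rewrite -?catA ?link_catr ?link_catl //.
    by case: (v) v0.
  by rewrite phi_cat pv add0r.
Qed.

(** For friendly segments, [u] is the image of a map between two semistable objects: it inherits the
    sign test on subobjects from one and that on quotients from the other. *)
Lemma wide_semistable lam : wide lam [set s | is_segment lam s /\ semistable s].
Proof.
split.
- by move=> s [].
- move=> s t u Ss St Su stu; apply/(card_setI3P _ (is_concat_uniq Ss stu)).
  have [s0 t0 uE] := is_concatE stu; subst u.
  have [e le] := seg_link Su.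
  split=> -[_ H1] [_ H2]; split=> //.
  + exact: semistable_cat.
  + exact: semistable_catr le H1 H2.
  + exact: semistable_catl le H1 H2.
- move=> s t u [Ss ss] [St st] f.
  have H e : dirsub e s u -> dirsub (~~ e) t u -> is_segment lam u /\ semistable u.
    move=> su tu; split.
      by apply: (subseg_segment Ss); case/(dirsubP _ _ (seg_uniq Ss))/and3P: su.
    move=> d r; case: (eq_or_negb e d) => -> ur.
      exact: semistable_sub ss su ur.
    exact: semistable_sub st tu ur.
  case: f => -[].
    by move=> /(SWsubP _ (seg_uniq Ss)) su /(NEsubP _ (seg_uniq St)); exact: H su.
  by move=> /(NEsubP _ (seg_uniq Ss)) su /(SWsubP _ (seg_uniq St)); exact: H su.
- move=> s1 s2 s3 s12 s S1 S2 S3 c1 c2 [Ss ss] [_ s2s] f.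
  have [s10 s20 E] := is_concatE c1; subst s12.
  have [_ s30 E] := is_concatE c2; subst s; rewrite -catA in Ss ss f.
  have U := seg_uniq Ss.
  have [e [x [y [E _ l1 l2]]]] : exists e, dirsub e (s1 ++ s2 ++ s3) s2.
    by case: f => [/(SWsubP _ U)|/(NEsubP _ U)] f; [exists false|exists true].
  have [xE yE] := uniq_cat_inj s20 U E; subst x y.
  by have [] := semistable_split ss s2s s10 s20 s30 l1 l2.
Qed.

End Semistable.

(** * Points of shards and separation by g-vectors *)

Section Shards.
Variables (R : realType) (lam : grid_shape).
Implicit Types (x : gspace R lam) (F : {fset seq grid_point}).

(** The value 0 off the interior vertices is never met along a segment. *)
Definition coord x (v : grid_point) : R := oapp x 0 (insub v).

Definition segsum x s : R := \sum_(v <- s) coord x v.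

Lemma segsum_cat x a b : segsum x (a ++ b) = segsum x a + segsum x b.
Proof. exact: big_cat. Qed.

Lemma segsum_cone x F (c : seq grid_point -> R) t : is_segment lam t ->
  (forall z, x z = \sum_(p <- F) c p * gvec R lam p z) ->
  segsum x t = \sum_(p <- F) c p * \sum_(v <- t) gturn R p v.
Proof.
move=> /and3P[_ /allP ti _] xE; rewrite /segsum.
under [RHS]eq_bigr do rewrite mulr_sumr.
rewrite exchange_big /=; apply: eq_big_seq => v /ti vi.
rewrite /coord insubT /= xE; apply: eq_bigr => p _; by rewrite ffunE.
Qed.

(** Each path of the face contributes with the right sign, since a wrong one would produce an odd
    maximal common run. *)
Lemma shard_semistable x s : is_segment lam s -> shard R lam s x -> semistable (segsum x) s.
Proof.
move=> Ss [F [[Fp _] Fev]] [c c0 xE] d t st.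
have St : is_segment lam t.
  by apply: (subseg_segment Ss); case/(dirsubP _ _ (seg_uniq Ss))/and3P: st.
rewrite (segsum_cone St xE) mulr_sumr big_seq; apply: sumr_ge0 => p pF.
rewrite mulrCA mulr_ge0 ?c0 // leNgt; apply/negP => neg.
have /and3P[pp _ _] := Fp p pF.
have [w tw pw] := negative_turns pp St neg.
have [wm ow] := dirsub_passes_max pp Ss (dirsub_trans st tw) pw.
by have := Fev p pF w wm; rewrite ow.
Qed.

Lemma passes_kiss d p q w : is_path lam p -> is_path lam q -> is_segment lam w ->
  passes d p w -> passes (~~ d) q w -> kiss lam p q.
Proof.
move=> pp pq Sw [a [b [pE a0 b0 l1 l2]]] [a' [b' [qE a'0 b'0 m1 m2]]].
have w0 := seg_nil Sw; exists w => //.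
have E e r k h : is_path lam r -> r = k ++ w ++ h -> k <> [::] -> link e k w -> enters e r w.
  move=> /is_path_sorted/sorted_step_uniq U rE /eqP k0 l; rewrite rE entersE -?rE //.
  by rewrite k0.
have L e r k h : is_path lam r -> r = k ++ w ++ h -> h <> [::] -> link e w h -> leaves e r w.
  move=> /is_path_sorted/sorted_step_uniq U rE /eqP h0 l; rewrite rE leavesE -?rE //.
  by rewrite h0.
rewrite negbK in m1.
case: d l1 l2 m1 m2 => l1 l2 m1 m2; [right|left]; split.
- exact: (E true _ _ _ pq qE).
- exact: (L false _ _ _ pq qE).
- exact: (E false _ _ _ pp pE).
- exact: (L true _ _ _ pp pE).
- exact: (E true _ _ _ pp pE).
- exact: (L false _ _ _ pp pE).
- exact: (E false _ _ _ pq qE).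
- exact: (L true _ _ _ pq qE).
Qed.

Lemma dirsub_passes d t w p : passes d p t -> dirsub (~~ d) t w -> passes d p w.
Proof.
move=> [a [b [-> a0 b0 l1 l2]]] [a' [b' [tE w0 m1 m2]]]; subst t.
exists (a ++ a'), (b' ++ b); split.
- by rewrite -!catA.
- by case: (a) a0.
- by case: (b') b0.
- case: (pselect (a' = [::])) l1 m1 => [->|a'0] l1 m1; last by rewrite link_catl.
  by rewrite cats0; exact: (link_catrW (t := w)) l1.
- case: (pselect (b' = [::])) l2 m2 => [->|b'0] l2 m2; last by rewrite link_catr // -[d]negbK.
  by move: l2; rewrite cats0 => /link_catlW.
Qed.

Lemma passes_sum d p t : is_path lam p -> t <> [::] -> passes d p t ->
  (-1) ^+ d * \sum_(v <- t) gturn R p v = -1.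
Proof.
move=> pp t0 [a [b [pE a0 b0 l1 l2]]].
rewrite (run_turns R (is_path_sorted pp) pE a0 t0 b0 l1 l2).1.
by case: (d); rewrite /= ?expr1 ?expr0; ring.
Qed.

Lemma semistable_shard x s F : is_segment lam s -> face lam F -> cone R lam F x ->
  semistable (segsum x) s -> shard R lam s x.
Proof.
move=> Ss [Fp Fk] [c c0 xE] ss.
(* A path of coefficient 0 may be odd along [s], so the face is first cut down to the paths really
   used. *)
pose G := [fset p in F | 0 < c p]%fset.
have GE p : p \in G = (p \in F) && (0 < c p) by rewrite !inE.
have sumG (h : seq grid_point -> R) : \sum_(p <- G) c p * h p = \sum_(p <- F) c p * h p.
  transitivity (\sum_(p <- F | 0 < c p) c p * h p).
    rewrite -[RHS]big_filter; apply/perm_big/uniq_perm; rewrite ?filter_uniq ?fset_uniq //.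
    by move=> p; rewrite mem_filter GE andbC.
  rewrite [RHS](bigID (fun p => 0 < c p)) /= [X in _ = _ + X]big1_seq ?addr0 // => p.
  move=> /andP[ncp pF]; have := c0 p pF; rewrite le_eqVlt (negbTE ncp) orbF.
  by move=> /eqP <-; rewrite mul0r.
exists G; last first.
  exists c => [p|v]; first by rewrite GE => /andP[_ /ltW].
  by rewrite xE sumG.
split.
  split=> [p|p q]; rewrite !GE => /andP[pF _]; first exact: Fp.
  by move=> /andP[qF _]; exact: Fk.
move=> p; rewrite GE => /andP[pF cp] t tm; apply/negP => ot.
have /and3P[pp _ _] := Fp p pF.
have [d st pt] := max_common_dirsub pp Ss tm ot.
have St : is_segment lam t.
  by apply: (subseg_segment Ss); case: tm.
(* The path [p] contributes [- c p] to a sum that should be nonnegative. No other path compensates,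
   because one with a contribution of the opposite sign would kiss [p]. *)
have := ss d t st; rewrite (segsum_cone St xE) mulr_sumr leNgt => /negP; apply.
rewrite (big_rem p) //= mulrCA (passes_sum pp (seg_nil St) pt) mulrN1.
apply: (@le_lt_trans _ _ (- c p + 0)); last by rewrite addr0 oppr_lt0.
rewrite lerD2l big_seq; apply: sumr_le0 => q /mem_rem qF.
rewrite mulrCA mulr_ge0_le0 ?c0 // leNgt; apply/negP => pos.
have /and3P[pq _ _] := Fp q qF.
have [|w tw qw] := negative_turns (d := ~~ d) (R := R) pq St.
  by move: pos; case: (d); rewrite /= ?expr0 ?expr1 ?mulN1r ?mul1r ?oppr_gt0 ?oppr_lt0.
have Sw : is_segment lam w.
  by apply: (subseg_segment St); case/(dirsubP _ _ (seg_uniq St))/and3P: tw.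
by apply: (Fk p q pF qF); apply: passes_kiss pp pq Sw (dirsub_passes pt tw) qw.
Qed.

(** The cone of the empty face is the origin, so no intersection of shards is empty. *)
Lemma shard0 s : shard R lam s [ffun=> 0].
Proof.
exists fset0; last by exists (fun=> 0) => // v; rewrite ffunE big_seq_fset0.
by split=> [|p]; [split=> p|]; rewrite ?inE.
Qed.

Lemma wide_shard x : wide lam [set s | is_segment lam s /\ shard R lam s x].
Proof.
case: (pselect (exists2 F, face lam F & cone R lam F x)) => [[F fF cF]|nF].
  have -> : [set s | is_segment lam s /\ shard R lam s x] =
            [set s | is_segment lam s /\ semistable (segsum x) s].
    apply/seteqP; split=> s [Ss H]; split=> //; first exact: shard_semistable.
    exact: semistable_shard fF cF H.
  exact/wide_semistable/segsum_cat.
(* A point outside the cones of all faces lies in no shard, and the empty set is wide. *)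
have -> : [set s | is_segment lam s /\ shard R lam s x] = set0.
  apply/seteqP; split=> // s [_ [F [fF _] cF]]; case: nF; by exists F.
split=> // s t u Ss St Su stu.
by apply/(card_setI3P _ (is_concat_uniq Ss stu)).
Qed.

Lemma straight_link d a t : sorted (fun y z => z == move d y) (a ++ t) -> link d a t.
Proof. by case: a t => [|x a] [|y t] //=; rewrite cat_path /= => /and3P[]. Qed.

Lemma passes_turning d e p w : w <> [::] -> passes d p w ->
  ~~ sorted (fun y z => z == move e y) p.
Proof.
move=> w0 [a [b [-> a0 b0 l1 l2]]]; apply/negP => srt.
have k1 := straight_link srt; rewrite link_catr // in k1.
have k2 : link e w b by apply: straight_link; case/cat_sorted2: srt.
have := link_inj a0 w0 l1 k1; have := link_inj w0 b0 l2 k2.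
by move=> <-; case: (d).
Qed.

(** Since [p] enters and leaves [w] in different directions it is not straight, and it cannot kiss
    itself because it enters a given segment in only one way. *)
Lemma passes_face d p w : is_path lam p -> w <> [::] -> passes d p w -> face lam [fset p]%fset.
Proof.
move=> pp w0 pw; split=> [q|q q']; rewrite !inE.
  move=> /eqP ->; rewrite pp /=.
  by rewrite (passes_turning true w0 pw) (passes_turning false w0 pw).
move=> /eqP -> /eqP ->.
have main s : Seg lam s -> ~ kiss_along p p s.
  move=> Ss [ew _ en _]; have s0 := seg_nil Ss.
  have U := sorted_step_uniq (is_path_sorted pp).
  have /infixP[a [b pE]] : infix s p.
    move: ew; case: (s) => // v s' /infixP[a [b ->]].
    by apply/infixP; exists (rcons a (west v)), b; rewrite cat_rcons.
  have : enters true p s by [].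
  have : enters false p s by [].
  rewrite pE !entersE -?pE // => /andP[/eqP a0 lf] /andP[_ lt].
  by have := link_inj a0 s0 lf lt.
by case=> s Ss []; exact: main.
Qed.

Lemma gvec_cone p : cone R lam [fset p]%fset (gvec R lam p).
Proof.
by exists (fun=> 1) => // v; rewrite big_seq_fset1 mul1r.
Qed.

Lemma wide_separation T s : wide lam T -> is_segment lam s -> ~ T s ->
  exists x, (forall t, T t -> shard R lam t x) /\ ~ shard R lam s x.
Proof.
move=> wT Ss nT.
have [d [u [a [b [su [a0 b0] [l1 l2] pp gp]]]]] := exists_good_path wT Ss nT.
set p := a ++ u ++ b in pp gp.
have Su : is_segment lam u.
  by apply: (subseg_segment Ss); case/(dirsubP _ _ (seg_uniq Ss))/and3P: su.
have u0 := seg_nil Su.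
have pu : passes d p u by exists a, b.
exists (gvec R lam p); split=> [t Tt|sp]; last first.
  (* The signed sum of the g-vector along [u] is [-1], where semistability asks for a nonnegative
     one. *)
  have := shard_semistable Ss sp su.
  have xE z : gvec R lam p z = \sum_(q <- [fset p]%fset) 1 * gvec R lam q z.
    by rewrite big_seq_fset1 mul1r.
  rewrite (segsum_cone (c := fun=> 1) Su xE) big_seq_fset1 mul1r.
  by rewrite (passes_sum pp u0 pu) oppr_ge0 ler10.
exists [fset p]%fset; last exact: gvec_cone.
split; first exact: passes_face pu.
move=> q; rewrite inE => /eqP -> w wm; apply/negP => ow.
(* An odd run along a member of [T] would be in [gen e], which goodness forbids. *)
have [e tw [a' [b' [pE a'0 b'0 m1 m2]]]] := max_common_dirsub pp (wide_seg wT Tt) wm ow.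
apply: (gp (~~ e) a' w b' pE a'0 b'0 m1); rewrite negbK //.
by exists t.
Qed.

(** * The Galois correspondence between shard intersections and wide sets *)

Definition shards_over (X : set (gspace R lam)) : set (seq grid_point) :=
  [set s | is_segment lam s /\ X `<=` shard R lam s].

Lemma wide_shards_over X : X !=set0 -> wide lam (shards_over X).
Proof.
move=> [x0 Xx0].
have -> : shards_over X = \bigcap_(T in
    [set [set s | is_segment lam s /\ shard R lam s x] | x in X]) T.
  rewrite bigcap_image; apply/seteqP; split=> s.
    by move=> [Ss Xs] x Xx; split=> //; exact: Xs.
  move=> H; split; first by case: (H x0 Xx0).
  by move=> x Xx; case: (H x Xx).
apply: wide_bigcap; first by exists [set s | is_segment lam s /\ shard R lam s x0], x0.
by move=> _ [x _ <-]; exact: wide_shard.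
Qed.

Lemma shard_intersection_nonempty (X : set (gspace R lam)) :
  is_shard_intersection X -> X !=set0.
Proof. by move=> [I _ ->]; exists [ffun=> 0] => s _; exact: shard0. Qed.

Lemma shards_overK (X : set (gspace R lam)) : is_shard_intersection X ->
  \bigcap_(s in shards_over X) shard R lam s = X.
Proof.
move=> [I IS XE]; apply/seteqP; split=> x; last by move=> Xx s [_]; exact.
move=> H; rewrite XE => s Is; apply: H; split; first exact: IS.
by rewrite XE => y; exact.
Qed.

Lemma wideK T : wide lam T -> shards_over (\bigcap_(s in T) shard R lam s) = T.
Proof.
move=> wT; apply/seteqP; split=> s.
  move=> [Ss H]; apply: contrapT => nT.
  by have [x [xT]] := wide_separation wT Ss nT; apply; exact: H.
by move=> Ts; split; [exact: wide_seg Ts|move=> x; exact].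
Qed.

End Shards.

Theorem theorem5p18 (R : realType) (lam : grid_shape) :
  exists f : Psi_f R lam -> Psi_w lam,
    bijective f /\ {mono f : X Y / (X <= Y)%O}.
Proof.
have siP (X : Psi_f R lam) : is_shard_intersection (val X) by exact/asboolP/(valP X).
have wP (T : Psi_w lam) : wide lam (val T) by exact/asboolP/(valP T).
have fP (X : Psi_f R lam) : `[< wide lam (shards_over (val X)) >].
  exact/asboolP/wide_shards_over/shard_intersection_nonempty.
have gP (T : Psi_w lam) :
    `[< is_shard_intersection (\bigcap_(s in val T) shard R lam s) >].
  by apply/asboolP; exists (val T) => //; case: (wP T).
exists (fun X => exist _ (shards_over (val X)) (fP X)); split.
  exists (fun T => exist _ (\bigcap_(s in val T) shard R lam s) (gP T)).
    by move=> X; apply: val_inj; exact: shards_overK.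
  by move=> T; apply: val_inj; exact: wideK.
move=> X Y; rewrite le_Psi_fE le_Psi_wE; apply: asbool_equiv_eq; split.
  (* Both sets are intersections of the shards over them, and more shards give a smaller
     intersection. *)
  move=> XY; rewrite -(shards_overK (siP X)) -(shards_overK (siP Y)) => x Yx s /XY.
  exact: Yx.
by move=> YX s [Ss Xs]; split=> //; exact: subset_trans YX Xs.
Qed.
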